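(* Let $\Pi$ be a topological parallelism on real projective 3-space $\mathrm{PG}(3,\mathbb{R})$. Then the automorphism group $\Phi=\mathrm{Aut}\,\Pi\le \mathrm{PGL}(4,\mathbb{R})$ is compact, and hence is conjugate (in $\mathrm{PGL}(4,\mathbb{R})$) to a closed subgroup of $\mathrm{PO}(4,\mathbb{R})$.
   Context: Points and lines of $\mathrm{PG}(3,\mathbb{R})$ are the 1- and 2-dimensional subspaces of $\mathbb{R}^4$, respectively. The point space $P$ and the line space $\mathcal{L}$ carry the usual (compact) Grassmann manifold topologies. A spread is a set of lines such that every point is incident with exactly one of them. A parallelism $\Pi$ on $\mathrm{PG}(3,\mathbb{R})$ is a set of spreads such that every line belongs to exactly one of them; equivalently, an equivalence relation on $\mathcal{L}$ (called parallelity) all of whose classes are spreads. For a point $p$ and a line $L$, $\Pi(p,L)$ denotes the unique line through $p$ parallel to $L$. The parallelism is called topological if the map $P\times\mathcal{L}\to\mathcal{L}$, $(p,L)\mapsto \Pi(p,L)$, is continuous. The automorphism group $\mathrm{Aut}\,\Pi$ is the subgroup of $\mathrm{PGL}(4,\mathbb{R})$ consisting of all collineations of $\mathrm{PG}(3,\mathbb{R})$ (induced by linear maps) that leave $\Pi$ invariant, i.e. that map parallel lines to parallel lines in both directions. $\mathrm{PO}(4,\mathbb{R})$ is the image of the orthogonal group $\mathrm{O}(4,\mathbb{R})$ in $\mathrm{PGL}(4,\mathbb{R})$. *)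

(* Defs.v *)
From HB Require Import structures.
From mathcomp Require Import all_boot all_order all_algebra.
From mathcomp Require Import all_classical all_reals all_analysis.

Set Implicit Arguments.
Unset Strict Implicit.
Unset Printing Implicit Defensive.

Import Order.TTheory GRing.Theory Num.Theory.
Import numFieldNormedType.Exports.

Local Open Scope classical_set_scope.
Local Open Scope ring_scope.
Local Open Scope quotient_scope.

(* Vectors of R^4 are row vectors, so a matrix A acts on the right:           *)
(* v |-> v *m A.                                                              *)

Section Grassmannian.
Variables (R : realType) (k : nat).

Definition frame := set_type [set A : 'M[R]_(k, 4) | row_free A].

Definition rowspan (A : 'M[R]_(k, 4)) : {vspace 'rV[R]_4} :=
  <<[seq row i A | i : 'I_k]>>%VS.

Definition basismx (U : {vspace 'rV[R]_4}) : 'M[R]_(k, 4) :=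
  \matrix_(i < k) (vbasis U)`_i.

Lemma row_free_rowsP (A : 'M[R]_(k, 4)) :
  row_free A <-> (forall u : 'rV[R]_k, u *m A = 0 -> u = 0).
Proof.
split=> [/row_free_inj Ainj u uA0|A0].
  by apply: Ainj; rewrite uA0 mul0mx.
rewrite -kermx_eq0; apply/eqP/row_matrixP => i.
by rewrite row0; apply: A0; rewrite -row_mul mulmx_ker row0.
Qed.

Lemma freeP_row_free (A : 'M[R]_(k, 4)) :
  free (mktuple (fun i => row i A)) = row_free A.
Proof.
apply/idP/idP => [/freeP fA|/row_free_rowsP fA].
  apply/row_free_rowsP => u; rewrite mulmx_sum_row => uA.
  apply/rowP => i; rewrite mxE; apply: (fA (fun i => u 0 i)).
  by rewrite -[RHS]uA; apply: eq_bigr => j _; rewrite (nth_mktuple _ _ j).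
apply/freeP => c c0 i.
have /rowP/(_ i) : \row_j c j = 0.
  apply: fA; rewrite mulmx_sum_row -[RHS]c0; apply: eq_bigr => j _.
  by rewrite (nth_mktuple _ _ j) mxE.
by rewrite !mxE.
Qed.

Lemma dim_rowspan (A : 'M[R]_(k, 4)) : row_free A -> \dim (rowspan A) == k.
Proof.
rewrite -freeP_row_free /free size_tuple.
by rewrite /rowspan /image_mem /= enumT.
Qed.

Lemma basismx_rows (U : {vspace 'rV[R]_4}) : \dim U == k ->
  [seq row i (basismx U) | i : 'I_k] = vbasis U.
Proof.
move=> /eqP dU; apply: (@eq_from_nth _ 0).
  by rewrite size_image card_ord size_tuple dU.
move=> i; rewrite size_image card_ord => ik.
rewrite (nth_map (Ordinal ik)) ?size_enum_ord//.
by rewrite rowK nth_enum_ord.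
Qed.

Lemma row_free_basismx (U : {vspace 'rV[R]_4}) : \dim U == k ->
  row_free (basismx U).
Proof.
move=> dU; rewrite -freeP_row_free.
have -> : (mktuple (fun i => row i (basismx U)) : seq _) = vbasis U.
  by rewrite -[RHS](basismx_rows dU) /image_mem /= enumT.
exact: basis_free (vbasisP U).
Qed.

Lemma basismxK (U : {vspace 'rV[R]_4}) : \dim U == k ->
  rowspan (basismx U) = U.
Proof.
by move=> dU; rewrite /rowspan basismx_rows//; exact: span_basis (vbasisP U).
Qed.

Definition dimspace := {U : {vspace 'rV[R]_4} | \dim U == k}.

Definition dimspace_pi (A : frame) : dimspace :=
  exist _ (rowspan (val A)) (dim_rowspan (set_mem (valP A))).

Definition dimspace_repr (U : dimspace) : frame :=
  exist _ (basismx (val U)) (mem_set (row_free_basismx (valP U))).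

Lemma dimspace_reprK : cancel dimspace_repr dimspace_pi.
Proof. by move=> U; apply: val_inj; rewrite /= basismxK// (valP U). Qed.

HB.instance Definition _ := isQuotient.Build frame dimspace dimspace_reprK.

(* The k-dimensional subspaces of R^4, with the Grassmann topology: the final *)
(* topology of the map sending a k-frame to its span. As a quotient topology, *)
(* this type has a canonical [val] into [frame]; the underlying subspace is   *)
(* [gspace].                                                                  *)
Definition grass := quotient_topology dimspace.

HB.instance Definition _ := Topological.on grass.
HB.instance Definition _ := Quotient.on grass.

Definition gspace (U : grass) : {vspace 'rV[R]_4} :=
  @sval _ (fun V => \dim V == k) U.

Lemma dim_gspace (U : grass) : \dim (gspace U) = k.
Proof. exact/eqP/(@svalP _ (fun V => \dim V == k)). Qed.

Lemma gspace_inj : injective gspace.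
Proof. by move=> U V; exact: (@val_inj _ _ dimspace). Qed.

Definition mk_grass (U : {vspace 'rV[R]_4}) (dU : \dim U == k) : grass :=
  exist _ U dU.

Lemma gspace_pi (A : frame) : gspace (\pi_grass A) = rowspan (val A).
Proof. by rewrite unlock. Qed.

End Grassmannian.

Notation point R := (grass R 1).
Notation line R := (grass R 2).

Section PGL.
Variable R : realType.

Definition GL4 := set_type [set A : 'M[R]_4 | A \in unitmx].

Lemma GL4P (A : GL4) : val A \in unitmx. Proof. exact: set_mem (valP A). Qed.

Definition mkGL4 (A : 'M[R]_4) (uA : A \in unitmx) : GL4 :=
  exist _ A (mem_set (uA : [set B : 'M[R]_4 | B \in unitmx] A)).

Lemma mkGL4K (A : 'M[R]_4) (uA : A \in unitmx) : val (mkGL4 uA) = A.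
Proof. by []. Qed.

Fact GL4_mul_unit (A B : GL4) : val A *m val B \in unitmx.
Proof. by rewrite unitmx_mul !GL4P. Qed.

Fact GL4_inv_unit (A : GL4) : invmx (val A) \in unitmx.
Proof. by rewrite unitmx_inv GL4P. Qed.

Definition GL4_mul (A B : GL4) : GL4 := mkGL4 (GL4_mul_unit A B).
Definition GL4_one : GL4 := mkGL4 (unitmx1 _ _).
Definition GL4_inv (A : GL4) : GL4 := mkGL4 (GL4_inv_unit A).

Fact GL4_mulA : associative GL4_mul.
Proof. by move=> A B C; apply: val_inj; rewrite /= mulmxA. Qed.
Fact GL4_mul1 : left_id GL4_one GL4_mul.
Proof. by move=> A; apply: val_inj; rewrite /= mul1mx. Qed.
Fact GL4_mulr1 : right_id GL4_one GL4_mul.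
Proof. by move=> A; apply: val_inj; rewrite /= mulmx1. Qed.
Fact GL4_mulV : left_inverse GL4_one GL4_inv GL4_mul.
Proof. by move=> A; apply: val_inj; rewrite /= mulVmx ?GL4P. Qed.
Fact GL4_mulrV : right_inverse GL4_one GL4_inv GL4_mul.
Proof. by move=> A; apply: val_inj; rewrite /= mulmxV ?GL4P. Qed.

HB.instance Definition _ := Topological.on GL4.
HB.instance Definition _ :=
  isGroup.Build GL4 GL4_mulA GL4_mul1 GL4_mulr1 GL4_mulV GL4_mulrV.

Definition proportional (A B : GL4) : bool :=
  `[< exists2 c : R, c != 0 & val A = c *: val B >].

Fact proportional_refl : reflexive proportional.
Proof. by move=> A; apply/asboolP; exists 1; rewrite ?oner_neq0 ?scale1r. Qed.

Fact proportional_sym : symmetric proportional.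
Proof.
have H A B : proportional A B -> proportional B A.
  move=> /asboolP[c c0 ABc]; apply/asboolP; exists c^-1; first by rewrite invr_eq0.
  by rewrite ABc scalerA mulVf// scale1r.
by move=> A B; apply/idP/idP => /H.
Qed.

Fact proportional_trans : transitive proportional.
Proof.
move=> B A C /asboolP[c c0 ABc] /asboolP[d d0 BCd]; apply/asboolP.
by exists (c * d); [rewrite mulf_neq0|rewrite ABc BCd scalerA].
Qed.

Canonical proportional_equiv := EquivRel proportional
  proportional_refl proportional_sym proportional_trans.

Definition PGL4 := quotient_topology {eq_quot proportional}.

HB.instance Definition _ := Topological.on PGL4.
HB.instance Definition _ := Quotient.on PGL4.

Definition pgl (A : GL4) : PGL4 := \pi_PGL4 A.

Lemma pgl_eqP (A B : GL4) :
  pgl A = pgl B <-> exists2 c : R, c != 0 & val A = c *: val B.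
Proof.
split=> [AB|cAB]; first by apply/asboolP/(@eqquotP _ _ {eq_quot proportional}).
exact/(@eqquotP _ _ {eq_quot proportional})/asboolP.
Qed.

Lemma pgl_repr (g : PGL4) : pgl (repr g) = g.
Proof. exact: reprK. Qed.

Lemma repr_pgl (A : GL4) :
  exists2 c : R, c != 0 & val (repr (pgl A)) = c *: val A.
Proof. exact/pgl_eqP/pgl_repr. Qed.

Definition PGL4_mul (g h : PGL4) : PGL4 := pgl (repr g * repr h)%g.
Definition PGL4_one : PGL4 := pgl 1%g.
Definition PGL4_inv (g : PGL4) : PGL4 := pgl (repr g)^-1%g.

Fact PGL4_mulE (A B : GL4) : PGL4_mul (pgl A) (pgl B) = pgl (A * B)%g.
Proof.
apply/pgl_eqP; have [c c0 cA] := repr_pgl A; have [d d0 dB] := repr_pgl B.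
exists (c * d); first by rewrite mulf_neq0.
by rewrite /= cA dB -scalemxAl -scalemxAr scalerA.
Qed.

Fact PGL4_invE (A : GL4) : PGL4_inv (pgl A) = pgl A^-1%g.
Proof.
apply/pgl_eqP; have [c c0 cA] := repr_pgl A.
exists c^-1; first by rewrite invr_eq0.
by rewrite /= cA invmxZ// -cA GL4P.
Qed.

Fact PGL4_mulA : associative PGL4_mul.
Proof.
move=> g h k; rewrite -(pgl_repr g) -(pgl_repr h) -(pgl_repr k).
by rewrite !PGL4_mulE mulgA.
Qed.
Fact PGL4_mul1 : left_id PGL4_one PGL4_mul.
Proof. by move=> g; rewrite -(pgl_repr g) PGL4_mulE mul1g. Qed.
Fact PGL4_mulr1 : right_id PGL4_one PGL4_mul.
Proof. by move=> g; rewrite -(pgl_repr g) PGL4_mulE mulg1. Qed.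
Fact PGL4_mulV : left_inverse PGL4_one PGL4_inv PGL4_mul.
Proof.
by move=> g; rewrite -(pgl_repr g) PGL4_invE PGL4_mulE mulVg.
Qed.
Fact PGL4_mulrV : right_inverse PGL4_one PGL4_inv PGL4_mul.
Proof.
by move=> g; rewrite -(pgl_repr g) PGL4_invE PGL4_mulE mulgV.
Qed.

HB.instance Definition _ :=
  isGroup.Build PGL4 PGL4_mulA PGL4_mul1 PGL4_mulr1 PGL4_mulV PGL4_mulrV.

Lemma pglM (A B : GL4) : pgl (A * B)%g = (pgl A * pgl B)%g.
Proof. exact: esym (PGL4_mulE A B). Qed.

Lemma pglV (A : GL4) : pgl A^-1%g = (pgl A)^-1%g.
Proof. exact: esym (PGL4_invE A). Qed.

Lemma pgl1 : pgl 1%g = 1%g. Proof. by []. Qed.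

Definition PO4 : set PGL4 :=
  [set pgl A | A in [set A : GL4 | val A *m (val A)^T = 1%:M]].

Definition is_subgroup (H : set PGL4) : Prop :=
  H 1%g /\ (forall g h, H g -> H h -> H (g * h^-1)%g).

End PGL.

Arguments PO4 : clear implicits.

Section Action.
Variables (R : realType) (k : nat).

Definition mximage (A : 'M[R]_4) (U : {vspace 'rV[R]_4}) : {vspace 'rV[R]_4} :=
  (linfun (mulmxr A) @: U)%VS.

Fact dim_mximage (A : GL4 R) (U : grass R k) :
  \dim (mximage (val A) (gspace U)) == k.
Proof.
apply/eqP; rewrite -[RHS](dim_gspace U) limg_dim_eq//.
apply/eqP; rewrite -subv0; apply/subvP => v.
rewrite memv_cap memv_ker lfunE /= memv0 => /andP[_ /eqP vA0].
by apply/eqP; rewrite -(mulmxK (GL4P A) v) vA0 mul0mx.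
Qed.

Definition collineation (g : PGL4 R) (U : grass R k) : grass R k :=
  mk_grass (dim_mximage (repr g) U).

Lemma collineation_pgl (A : GL4 R) (U : grass R k) :
  gspace (collineation (pgl A) U) = mximage (val A) (gspace U).
Proof.
have [c c0 cA] := repr_pgl A.
rewrite [LHS]/= /mximage cA; apply/eqP; rewrite eqEsubv; apply/andP; split.
  apply/subvP => _ /memv_imgP[v vU ->]; rewrite lfunE /= -scalemxAr.
  by apply: memvZ; rewrite -[v *m _](lfunE (mulmxr (val A))) memv_img.
apply/subvP => _ /memv_imgP[v vU ->]; rewrite lfunE /=.
rewrite -[v *m _]scale1r -(mulVf c0) -scalerA scalemxAr memvZ//.
by rewrite -[v *m _](lfunE (mulmxr (c *: val A))) memv_img.
Qed.

Lemma collineation1 (U : grass R k) : collineation 1%g U = U.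
Proof.
apply: gspace_inj; rewrite -pgl1 collineation_pgl -[RHS]lim1g.
by apply: eq_in_limg => v _; rewrite lfunE id_lfunE /= mulmx1.
Qed.

Lemma collineationM (g h : PGL4 R) (U : grass R k) :
  collineation (g * h)%g U = collineation h (collineation g U).
Proof.
apply: gspace_inj; rewrite -(pgl_repr g) -(pgl_repr h) -pglM !collineation_pgl.
rewrite /mximage -limg_comp; apply: eq_in_limg => v _.
by rewrite comp_lfunE !lfunE /= mulmxA.
Qed.

End Action.

Section Parallelism.
Variable R : realType.
Implicit Types (p : point R) (L M : line R) (S : set (line R))
  (Pi : set (set (line R))).

Definition incident p L : Prop := (gspace p <= gspace L)%VS.

Definition spread S : Prop := forall p, exists! L, S L /\ incident p L.

Definition parallelism Pi : Prop :=
  Pi `<=` spread /\ forall L, exists! S, Pi S /\ S L.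

Definition parallel Pi L M : Prop := exists2 S, Pi S & S L /\ S M.

(* The default value L is irrelevant when Pi is a parallelism: see            *)
(* [parallel_throughP].                                                       *)
Definition parallel_through Pi p L : line R :=
  xget L [set M | incident p M /\ parallel Pi M L].

Lemma parallel_throughP Pi p L M : parallelism Pi ->
  (incident p M /\ parallel Pi M L) <-> M = parallel_through Pi p L.
Proof.
move=> [Pspread Ppart].
have [S [[PS SL] Suniq]] := Ppart L.
have [N [[SN pN] Nuniq]] := Pspread _ PS p.
have NM M' : incident p M' /\ parallel Pi M' L -> N = M'.
  move=> [pM' [S' PS' [S'M' S'L]]]; apply: Nuniq; split => //.
  by rewrite (Suniq S').
have hN : incident p N /\ parallel Pi N L by split => //; exists S.
rewrite /parallel_through; case: xgetP => [M' _ /= hM'|/(_ N)//].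
by split=> [/NM <-|->//]; rewrite -(NM _ hM').
Qed.

Definition topological_parallelism Pi : Prop :=
  parallelism Pi /\
  continuous (fun pL : point R * line R => parallel_through Pi pL.1 pL.2).

Definition Aut Pi : set (PGL4 R) :=
  [set g | forall L M,
    parallel Pi L M <-> parallel Pi (collineation g L) (collineation g M)].

Lemma is_subgroup_Aut Pi : is_subgroup (Aut Pi).
Proof.
split=> [L M|g h Ag Ah L M]; first by rewrite !collineation1.
have hK X : collineation h (collineation h^-1%g X) = X :> line R.
  by rewrite -collineationM mulVg collineation1.
rewrite !collineationM; apply: iff_trans (Ag L M) _.
by apply: iff_sym; apply: iff_trans (Ah _ _) _; rewrite !hK.
Qed.

End Parallelism.

(* Main.v *)
Require Import Defs.
From HB Require Import structures.
From mathcomp Require Import all_boot all_order all_algebra.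
From mathcomp Require Import all_classical all_reals all_analysis.
From mathcomp Require Import perm ring lra.

Set Implicit Arguments.
Unset Strict Implicit.
Unset Printing Implicit Defensive.

Import Order.TTheory GRing.Theory Num.Theory.
Import numFieldNormedType.Exports.

Local Open Scope classical_set_scope.
Local Open Scope ring_scope.
Local Open Scope quotient_scope.

(** Let an ultrafilter on PGL(4,R) contain Aut Pi, and write its elements, by
    Gaussian elimination with complete pivoting, as g = X D Y with X and Y in a
    compact set of invertible matrices and D = diag(d_0, ..., d_3) with bounded
    ratios d_{i+1}/d_i. Along the ultrafilter X, Y and the ratios converge; if no
    ratio tends to 0, then g converges in PGL(4,R), and the limit lies in Aut Pi,
    which is closed. Otherwise g degenerates, and comparing the limits of the
    images of parallel lines gives a contradiction, since limits of parallel
    lines are parallel and two parallel lines that meet coincide: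
    - if d_1/d_0 -> 0 but d_2/d_1 does not, all lines outside a plane H acquire a
      common point in the limit, whereas their points in H stay distinguishable;
    - if d_2/d_1 -> 0, the images of lines disjoint from the kernel line K, and
      of lines converging to such lines, tend to one line I. Choose lines M_g,
      with a limit M meeting K in one point, whose images tend to a line that
      meets I in one point; as M is parallel to a line disjoint from K, that
      line must be parallel to I;
    - if only d_3/d_2 -> 0, the images of the lines parallel to a line through
      the kernel point are pushed into one plane, hence coincide.

    A compact subgroup fixes a positive definite form: among the uniformly
    positive symmetric S, the supremum of |A S A^T|^2 (Frobenius norm) over the
    elements A of determinant +-1 is invariant and strictly convex, so its
    minimizer is unique, hence invariant. A Cholesky factor of this form
    conjugates the group into PO(4,R). *)

(** * Limits of matrices *)

Section MatrixLimits.
Variables (R : realType) (T : Type) (F : set_system T).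
Context {FF : ProperFilter F}.

Lemma cvg_mxP m n (f : T -> 'M[R]_(m, n)) (A : 'M[R]_(m, n)) :
  f @ F --> A <-> forall i j, (fun t => f t i j) @ F --> A i j.
Proof.
split=> [fA i j U UA|fA U [P PA PU]].
  have /fA : nbhs A [set B : 'M[R]_(m, n) | U (B i j)]; last by [].
  exists (fun i' j' => if (i' == i) && (j' == j) then U else setT).
    move=> i' j'; case: ifP => [/andP[/eqP -> /eqP ->]//|_]; exact: filterT.
  by move=> B /(_ i j); rewrite !eqxx.
have : F [set t | forall ij : 'I_m * 'I_n, P ij.1 ij.2 (f t ij.1 ij.2)].
  apply: (@filter_forall T ('I_m * 'I_n)%type
    (fun ij => [set t | P ij.1 ij.2 (f t ij.1 ij.2)]) F).
  by move=> -[i j] /=; exact: fA i j _ (PA i j).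
move=> FP; suff: F (f @^-1` U) by [].
by apply: filterS FP => t Pt; apply: PU => i j; exact: Pt (i, j).
Qed.

Lemma near_cvg_eq (S : topologicalType) (f g : T -> S) (l : S) :
  (\forall t \near F, f t = g t) -> f @ F --> l -> g @ F --> l.
Proof. by move=> fg; apply: cvg_trans; exact: near_eq_cvg. Qed.

Lemma cvg_sumr (I : Type) (r : seq I) (p : pred I) (f : I -> T -> R) (l : I -> R) :
  (forall i, p i -> f i @ F --> l i) ->
  (fun t => \sum_(i <- r | p i) f i t) @ F --> \sum_(i <- r | p i) l i.
Proof.
move=> fl; elim: r => [|i r IHr].
  by under eq_fun do rewrite big_nil; rewrite big_nil; exact: cvg_cst.
under eq_fun do rewrite big_cons; rewrite big_cons.
by case: ifP => // pi; apply: cvgD => //; apply: fl.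
Qed.

Lemma cvg_prodr (I : Type) (r : seq I) (f : I -> T -> R) (l : I -> R) :
  (forall i, f i @ F --> l i) ->
  (fun t => \prod_(i <- r) f i t) @ F --> \prod_(i <- r) l i.
Proof.
move=> fl; elim: r => [|i r IHr].
  by under eq_fun do rewrite big_nil; rewrite big_nil; exact: cvg_cst.
by under eq_fun do rewrite big_cons; rewrite big_cons; exact: cvgM.
Qed.

Lemma cvg_mulmx m n p (f : T -> 'M[R]_(m, n)) (g : T -> 'M[R]_(n, p))
    (A : 'M[R]_(m, n)) (B : 'M[R]_(n, p)) :
  f @ F --> A -> g @ F --> B -> (fun t => f t *m g t) @ F --> A *m B.
Proof.
move=> /cvg_mxP fA /cvg_mxP gB; apply/cvg_mxP => i j.
under eq_fun do rewrite mxE; rewrite mxE.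
by apply: cvg_sumr => k _; exact: cvgM.
Qed.

Lemma cvg_mulmxl m n p (C : 'M[R]_(m, n)) (f : T -> 'M[R]_(n, p)) (A : 'M[R]_(n, p)) :
  f @ F --> A -> (fun t => C *m f t) @ F --> C *m A.
Proof. by move=> fA; apply: cvg_mulmx => //; exact: cvg_cst. Qed.

Lemma cvg_mulmxr m n p (f : T -> 'M[R]_(m, n)) (A : 'M[R]_(m, n)) (C : 'M[R]_(n, p)) :
  f @ F --> A -> (fun t => f t *m C) @ F --> A *m C.
Proof. by move=> fA; apply: cvg_mulmx => //; exact: cvg_cst. Qed.

Lemma cvg_trmx m n (f : T -> 'M[R]_(m, n)) (A : 'M[R]_(m, n)) :
  f @ F --> A -> (fun t => (f t)^T) @ F --> A^T.
Proof.
move=> /cvg_mxP fA; apply/cvg_mxP => i j.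
under eq_fun do rewrite mxE; rewrite mxE; exact: fA.
Qed.

Lemma cvg_scalemx m n (c : T -> R) (f : T -> 'M[R]_(m, n)) (l : R)
    (A : 'M[R]_(m, n)) :
  c @ F --> l -> f @ F --> A -> (fun t => c t *: f t) @ F --> l *: A.
Proof.
move=> cl /cvg_mxP fA; apply/cvg_mxP => i j.
under eq_fun do rewrite mxE; rewrite mxE; exact: cvgM.
Qed.

Lemma cvg_det n (f : T -> 'M[R]_n) (A : 'M[R]_n) :
  f @ F --> A -> (fun t => \det (f t)) @ F --> \det A.
Proof.
move=> /cvg_mxP fA; apply: cvg_sumr => s _.
by apply: cvgM; [exact: cvg_cst|exact: cvg_prodr].
Qed.

Lemma cvg_adjugate n (f : T -> 'M[R]_n) (A : 'M[R]_n) :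
  f @ F --> A -> (fun t => \adj (f t)) @ F --> \adj A.
Proof.
move=> /cvg_mxP fA; apply/cvg_mxP => i j.
under eq_fun do rewrite mxE; rewrite mxE.
apply: cvgM; first exact: cvg_cst.
apply: cvg_det; apply/cvg_mxP => k l.
under eq_fun do rewrite !mxE; rewrite !mxE; exact: fA.
Qed.

Lemma near_unitmx n (f : T -> 'M[R]_n) (A : 'M[R]_n) :
  f @ F --> A -> A \in unitmx -> \forall t \near F, f t \in unitmx.
Proof.
move=> fA; rewrite unitmxE unitfE => A0.
near=> t; rewrite unitmxE unitfE.
near: t; exact: cvgr_neq0 (cvg_det fA) A0.
Unshelve. all: by end_near. Qed.

Lemma cvg_invmx n (f : T -> 'M[R]_n) (A : 'M[R]_n) :
  f @ F --> A -> A \in unitmx -> (fun t => invmx (f t)) @ F --> invmx A.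
Proof.
move=> fA uA; have fu := near_unitmx fA uA.
have -> : invmx A = (\det A)^-1 *: \adj A by rewrite /invmx uA.
apply: (@near_cvg_eq _ (fun t => (\det (f t))^-1 *: \adj (f t))).
  by apply: filterS fu => t ut; rewrite /invmx ut.
apply: cvg_scalemx; last exact: cvg_adjugate.
by apply: cvgV; [rewrite -unitfE -unitmxE|exact: cvg_det].
Qed.

Lemma cvg_mx_uniq m n (f : T -> 'M[R]_(m, n)) (A B : 'M[R]_(m, n)) :
  f @ F --> A -> f @ F --> B -> A = B.
Proof.
move=> /cvg_mxP fA /cvg_mxP fB; apply/matrixP => i j.
exact: cvg_unique (fA i j) (fB i j).
Qed.

End MatrixLimits.

(** * Limits along ultrafilters *)

Section UltraLimits.
Variables (R : realType) (T : Type) (F : set_system T).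
Context {FU : UltraFilter F}.

Lemma ultra_fmap (S : Type) (f : T -> S) : UltraFilter (f @ F).
Proof.
split=> [|G GF FG]; first exact: fmap_proper_filter.
rewrite predeqE => A; split=> [GA|]; last exact: FG.
have [//|FnA] := in_ultra_setVsetC (f @^-1` A) FU.
by have /filter_ex[x []] : G (A `&` ~` A) by apply: filterI => //; exact: FG.
Qed.

(** Compactness of the segment from [- M] to [M] takes the place of extracting convergent
    subsequences. *)
Lemma ultra_bounded_cvg (f : T -> R) (M : R) :
  (\forall t \near F, `|f t| <= M) -> exists l : R, f @ F --> l.
Proof.
move=> fM; have := @segment_compact R (- M) M; rewrite compact_ultra.
move=> /(_ (f @ F)); case.
  exact: ultra_fmap.
- by apply: filterS fM => t; rewrite /= in_itv /= -ler_norml.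
- by move=> l [_ fl]; exists l.
Qed.

Lemma ultra_bounded_mx_cvg m n (f : T -> 'M[R]_(m, n)) (M : R) :
  (\forall t \near F, forall i j, `|f t i j| <= M) -> exists A : 'M[R]_(m, n), f @ F --> A.
Proof.
move=> fM.
have /choice[l fl] (ij : 'I_m * 'I_n) : exists l : R, (fun t => f t ij.1 ij.2) @ F --> l.
  by apply: (@ultra_bounded_cvg _ M); apply: filterS fM => t /(_ ij.1 ij.2).
by exists (\matrix_(i, j) l (i, j)); apply/cvg_mxP => i j; rewrite mxE; exact: (fl (i, j)).
Qed.

End UltraLimits.

(** * Frames and the Grassmann topology *)

Section Spans.
Variable R : realType.

Definition spans k (B : 'M[R]_(k, 4)) (U : grass R k) : Prop :=
  rowspan B = gspace U.

Lemma mem_rowspan k (B : 'M[R]_(k, 4)) v : (v \in rowspan B) = (v <= B)%MS.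
Proof.
apply/idP/idP => [|/submxP[c ->]].
  move=> /coord_span ->; apply: summx_sub => i _; apply: scalemx_sub.
  have /mapP[j _ ->] : (in_tuple [seq row j B | j : 'I_k])`_i \in [seq row j B | j : 'I_k].
    by apply: mem_nth; rewrite size_image; exact: ltn_ord.
  exact: (row_sub (j : 'I_k) B).
rewrite mulmx_sum_row; apply: memv_suml => i _; apply: memvZ.
by apply: memv_span; apply: map_f; rewrite mem_enum.
Qed.

Lemma spans_mem k (B : 'M[R]_(k, 4)) U v :
  spans B U -> (v \in gspace U) = (v <= B)%MS.
Proof. by rewrite /spans => <-; exact: mem_rowspan. Qed.

Lemma spans_row_free k (B : 'M[R]_(k, 4)) U : spans B U -> row_free B.
Proof.
move=> BU; rewrite -freeP_row_free /free size_tuple.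
by rewrite -[X in _ == X](dim_gspace U) -BU /rowspan /image_mem /= enumT.
Qed.

Lemma exists_frame k (U : grass R k) : exists B, spans B U.
Proof.
by exists (basismx k (gspace U)); apply: basismxK; rewrite dim_gspace.
Qed.

Lemma exists_span k (B : 'M[R]_(k, 4)) : row_free B -> exists U, spans B U.
Proof. by move=> fB; exists (mk_grass (dim_rowspan fB)). Qed.

Lemma spans_sub k l (B : 'M[R]_(k, 4)) (C : 'M[R]_(l, 4)) U V :
  spans B U -> spans C V -> (gspace U <= gspace V)%VS = (B <= C)%MS.
Proof.
move=> BU CV; apply/subvP/row_subP => [UV i|BC v].
  by rewrite -(spans_mem _ CV) UV// (spans_mem _ BU) row_sub.
by rewrite (spans_mem _ BU) (spans_mem _ CV) => /submx_trans; apply; apply/row_subP.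
Qed.

Lemma spans_eqP k (B C : 'M[R]_(k, 4)) U V :
  spans B U -> spans C V -> U = V <-> (B <= C)%MS.
Proof.
move=> BU CV; rewrite -(spans_sub BU CV); split=> [->//|UV].
by apply: gspace_inj; apply/eqP; rewrite eqEdim UV !dim_gspace leqnn.
Qed.

Lemma spans_mull k (A : 'M[R]_k) (B : 'M[R]_(k, 4)) U :
  A \in unitmx -> spans B U -> spans (A *m B) U.
Proof.
move=> uA BU; rewrite /spans -BU; apply/vspaceP => v; rewrite !mem_rowspan.
by rewrite (eqmxMfull B) ?row_full_unit.
Qed.

Lemma spans_collineation k (B : 'M[R]_(k, 4)) U (A : GL4 R) :
  spans B U -> spans (B *m val A) (collineation (pgl A) U).
Proof.
move=> BU; rewrite /spans collineation_pgl; apply/vspaceP => v.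
rewrite mem_rowspan; apply/idP/memv_imgP => [/submxP[c ->]|[w wU ->]].
  exists (c *m B); last by rewrite lfunE /= mulmxA.
  by rewrite (spans_mem _ BU) submxMl.
by rewrite lfunE /= submxMr// -(spans_mem _ BU).
Qed.

End Spans.

Section GrassLimits.
Variables (R : realType) (k : nat).

Lemma cvg_set_type (X : topologicalType) (A : set X) (F : set_system A) (a : A) :
  Filter F -> set_val @ F --> set_val a -> F --> a.
Proof.
move=> FF Fa U; rewrite nbhsE => -[V [oV Va] VU]; apply: filterS VU _.
case: oV => W oW WV; rewrite -WV; apply: Fa; apply: open_nbhs_nbhs; split=> //.
by move: Va; rewrite -WV.
Qed.

(** The Grassmann topology makes the map from frames to their spans continuous, so limits of frames
    give limits of subspaces. *)
Lemma cvg_span (T : Type) (F : set_system T) (m : T -> grass R k)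
    (b : T -> 'M[R]_(k, 4)) (B : 'M[R]_(k, 4)) U {FF : ProperFilter F} :
  b @ F --> B -> spans B U -> (\forall t \near F, spans (b t) (m t)) ->
  m @ F --> U.
Proof.
move=> bB BU bm.
pose fr C (fC : row_free C) : frame R k := exist _ C (mem_set fC).
(* Where [b t] is not a frame, the frame [B] of the limit serves as default; near [F] this does not
   occur. *)
pose f t : frame R k :=
  if pselect (row_free (b t)) is left fb then fr _ fb else fr _ (spans_row_free BU).
have fE : \forall t \near F, val (f t) = b t.
  apply: filterS bm => t /spans_row_free bt; rewrite /f.
  by case: pselect.
have piU : \pi_(grass R k) (fr _ (spans_row_free BU)) = U.
  by apply: gspace_inj; rewrite gspace_pi.
apply: (@near_cvg_eq _ _ _ _ (fun t => \pi_(grass R k) (f t))).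
  near=> t; apply: gspace_inj; rewrite gspace_pi.
  by rewrite (near fE t)//; near: t.
rewrite -piU; apply: continuous_cvg; first exact: pi_continuous.
apply: cvg_set_type; apply: (@near_cvg_eq _ _ _ _ b) => //.
by apply: filterS fE => t.
Unshelve. all: by end_near. Qed.

(** On the affine chart of subspaces meeting the kernel of [C] trivially, for [C] of rank [k], this
    is the unique frame whose product with [C] is the identity. It does not depend on the frame it
    is computed from. *)
Definition grass_section (C : 'M[R]_(4, k)) (U : grass R k) : 'M[R]_(k, 4) :=
  let B := val (repr U) in invmx (B *m C) *m B.

Lemma spans_repr (U : grass R k) : spans (val (repr U)) U.
Proof. by rewrite /spans -gspace_pi reprK. Qed.

Lemma spans_change (B B' : 'M[R]_(k, 4)) U : spans B U -> spans B' U ->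
  exists2 K, K \in unitmx & B' = K *m B.
Proof.
move=> BU B'U; have /(spans_eqP B'U BU)/submxP[K BE] := erefl U.
exists K => //; have := spans_row_free B'U.
rewrite BE -row_free_unit -!row_leq_rank => /leq_trans; apply.
exact: mxrankM_maxl.
Qed.

Lemma grass_sectionE (C : 'M[R]_(4, k)) B U : spans B U -> B *m C \in unitmx ->
  grass_section C U = invmx (B *m C) *m B.
Proof.
move=> BU uBC; have [K uK rE] := spans_change BU (spans_repr U).
have uKBC : K *m (B *m C) \in unitmx by rewrite unitmx_mul uK.
rewrite /grass_section rE -mulmxA.
have -> : K *m B = K *m (B *m C) *m (invmx (B *m C) *m B).
  by rewrite -mulmxA mulKVmx.
by rewrite mulKmx.
Qed.

(** This is continuity of the section at [U], together with openness of the chart. Openness in the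
    quotient is checked on frames, where the section is a continuous matrix expression. *)
Lemma cvg_grass_section (C : 'M[R]_(4, k)) B (U : grass R k) :
  spans B U -> B *m C = 1%:M ->
  forall N, nbhs B N ->
  nbhs U [set V | val (repr V) *m C \in unitmx /\ N (grass_section C V)].
Proof.
move=> BU BC1 N; rewrite nbhsE => -[N' [oN' N'B] N'N].
have uBC : B *m C \in unitmx by rewrite BC1 unitmx1.
have uE V A : spans A V -> (val (repr V) *m C \in unitmx) = (A *m C \in unitmx).
  move=> /spans_change/(_ (spans_repr V))[K uK ->].
  by rewrite -mulmxA unitmx_mul uK.
pose W := [set V : grass R k | val (repr V) *m C \in unitmx /\ N' (grass_section C V)].
have WU : W U.
  by split; [rewrite (uE _ _ BU)|rewrite (grass_sectionE BU)// BC1 invmx1 mul1mx].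
suff oW : open W.
  have : nbhs U W by apply: open_nbhs_nbhs.
  by apply: filterS => V [uV NV]; split=> //; exact: N'N.
have spi (A : frame R k) : spans (val A) (\pi_(grass R k) A) by rewrite /spans gspace_pi.
rewrite /open /= /quotient_open openE => A [].
rewrite (uE _ _ (spi A)) => uA; rewrite (grass_sectionE (spi A))// => NA.
have PFA : ProperFilter (nbhs A : set_system (frame R k)) := nbhs_pfilter A.
have vA : (fun A' : frame R k => val A') @ A --> val A by exact: initial_continuous.
have vAC : (fun A' : frame R k => val A' *m C) @ A --> val A *m C.
  exact: (@cvg_mulmxr _ _ _ PFA).
have vS : (fun A' : frame R k => invmx (val A' *m C) *m val A') @ A -->
    invmx (val A *m C) *m val A.
  exact: (@cvg_mulmx _ _ _ PFA _ _ _ _ _ _ _ (@cvg_invmx _ _ _ PFA _ _ _ vAC uA) vA).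
have NA' := vS _ (open_nbhs_nbhs (conj oN' NA)).
have uA' := @near_unitmx _ _ _ PFA _ _ _ vAC uA.
have : nbhs A [set A' : frame R k | val A' *m C \in unitmx /\
    N' (invmx (val A' *m C) *m val A')] by exact: (filterI uA' NA').
apply: filterS => A' [uA'C NA'C].
by split; rewrite /= ?(uE _ _ (spi A'))// (grass_sectionE (spi A')).
Qed.

(** Converse of [cvg_span]: normalising by a right inverse [C] of [B] selects frames that
    converge. *)
Lemma cvg_frame (T : Type) (F : set_system T) (m : T -> grass R k)
    (B : 'M[R]_(k, 4)) U {FF : ProperFilter F} :
  m @ F --> U -> spans B U ->
  exists2 b, b @ F --> B & \forall t \near F, spans (b t) (m t).
Proof.
move=> mU BU; have /row_freeP[C BC1] := spans_row_free BU.
have near_sec N := cvg_grass_section BU BC1 (N := N).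
exists (fun t => grass_section C (m t)).
  move=> N /near_sec/mU FN; suff: F [set t | N (grass_section C (m t))] by [].
  by apply: (@filterS _ F _ _ _ _ FN) => t [].
have /near_sec/mU FT : nbhs B setT by exact: filterT.
apply: (@filterS _ F _ _ _ _ FT) => t [ut _].
by apply: spans_mull; [rewrite unitmx_inv|exact: spans_repr].
Qed.

(** Two frames [b], [b'] of one subspace satisfy [b' = b' *m C *m invmx (b *m C) *m b]; in the limit
    [B'] becomes a multiple of [B]. So the Grassmannian is Hausdorff. *)
Lemma grass_cvg_uniq (T : Type) (F : set_system T) (m : T -> grass R k)
    (U V : grass R k) {FF : ProperFilter F} :
  m @ F --> U -> m @ F --> V -> U = V.
Proof.
move=> mU mV; have [B BU] := exists_frame U; have [B' B'V] := exists_frame V.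
have [b bB bm] := cvg_frame mU BU; have [b' bB' bm'] := cvg_frame mV B'V.
have /row_freeP[C BC1] := spans_row_free BU.
have bC : (fun t => b t *m C) @ F --> (1%:M : 'M[R]_k).
  by rewrite -BC1; exact: cvg_mulmxr.
have b'lim : (fun t => b' t *m C *m invmx (b t *m C) *m b t) @ F -->
   B' *m C *m invmx (1%:M : 'M[R]_k) *m B.
  apply: cvg_mulmx => //; apply: cvg_mulmx; last exact: cvg_invmx (unitmx1 _ _).
  exact: cvg_mulmxr.
have ub : \forall t \near F, b t *m C \in unitmx.
  exact: near_unitmx bC (unitmx1 _ _).
have /(cvg_mx_uniq bB') B'E : b' @ F --> B' *m C *m invmx (1%:M : 'M[R]_k) *m B.
  suff eb : \forall t \near F, b' t *m C *m invmx (b t *m C) *m b t = b' t.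
    exact: near_cvg_eq eb b'lim.
  apply: filterS3 bm bm' ub => t bmt bmt' ubt.
  by have [K _ ->] := spans_change bmt bmt'; rewrite -(mulmxA K) mulmxK.
by apply/esym/(spans_eqP B'V BU); rewrite B'E submxMl.
Qed.

End GrassLimits.

(** * Gaussian elimination with complete pivoting *)

Section PivotDecomposition.
Variable R : realType.

(** Moving an entry of largest modulus to the corner makes all multipliers at most 1, and the Schur
    complement has entries at most twice the pivot. The bound on [d 0] carries this estimate through
    the induction. Determinants of modulus 1 will keep the limits of [X] and [Y] invertible. *)
Lemma pivot_decomposition n (A : 'M[R]_n) : A \in unitmx ->
  exists X Y : 'M[R]_n, exists d : nat -> R,
  [/\ A = X *m diag_mx (\row_(i < n) d i) *m Y,
      (forall i j, `|X i j| <= 1 /\ `|Y i j| <= 1),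
      `|\det X| = 1 /\ `|\det Y| = 1,
      (forall M : R, (0 < n)%N -> (forall i j, `|A i j| <= M) -> `|d 0%N| <= M) &
      forall i, (i < n)%N -> d i != 0 /\ ((i.+1 < n)%N -> `|d i.+1| <= 2 * `|d i|)].
Proof.
elim: n A => [|n IHn] A uA.
  exists 1%:M, 1%:M, (fun=> 0); split=> //; last by rewrite det1 normr1.
  + by apply/matrixP => -[].
  + by case.
pose p := [arg max_(p > (ord0, ord0) : 'I_n.+1 * 'I_n.+1) `|A p.1 p.2|]%O.
have pmax i j : `|A i j| <= `|A p.1 p.2|.
  by rewrite /p; case: arg_maxP => //= q _ /(_ (i, j)); exact.
have a0 : A p.1 p.2 != 0.
  apply: contraL uA => /eqP a0; have -> : A = 0; last by rewrite unitmxE det0 unitr0.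
  apply/matrixP => i j; rewrite mxE; apply/eqP; rewrite -normr_eq0 eq_le normr_ge0 andbT.
  by rewrite (le_trans (pmax i j))// a0 normr0.
pose P := tperm_mx ord0 p.1 : 'M[R]_n.+1; pose Q := tperm_mx ord0 p.2 : 'M[R]_n.+1.
pose A' : 'M[R]_(1 + n) := xrow ord0 p.1 (xcol ord0 p.2 A).
have AE : A = P *m A' *m Q.
  rewrite /A' xrowE xcolE /P /Q !mulmxA -perm_mxM tperm2 perm_mx1 mul1mx.
  by rewrite -mulmxA -perm_mxM tperm2 perm_mx1 mulmx1.
have A'E i j : A' i j = A (tperm ord0 p.1 i) (tperm ord0 p.2 j) by rewrite !mxE.
clearbody A'.
have uA' : A' \in unitmx.
  by move: uA; rewrite AE !unitmx_mul => /andP[/andP[]].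
set a := A p.1 p.2 in pmax a0.
have A'00 : A' 0 0 = a by rewrite A'E !tpermL.
have A'max i j : `|A' i j| <= `|a| by rewrite A'E.
(* [S] is the Schur complement of the pivot [a]. *)
pose b := ursubmx A'; pose c := dlsubmx A'; pose S := drsubmx A' - a^-1 *: c *m b.
have A'b : A' = block_mx a%:M b c (drsubmx A').
  rewrite -[LHS]submxK; congr block_mx; apply/matrixP => i j; rewrite !ord1 !mxE.
  by rewrite mulr1n -A'00; congr (A' _ _); apply/val_inj.
have A'LU : A' = block_mx 1%:M 0 (a^-1 *: c) 1%:M *m block_mx a%:M b 0 S.
  rewrite [LHS]A'b mulmx_block !mul0mx !mul1mx !addr0 mul_mx_scalar scalerA mulfV// scale1r.
  by rewrite /S addrC subrK.
have uS : S \in unitmx.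
  have := uA'; rewrite A'LU unitmx_mul => /andP[_].
  by rewrite !unitmxE det_ublock unitrM => /andP[].
have [X1 [Y1 [d1 [SE XY1 [dX1 dY1] d1max d1P]]]] := IHn S uS.
pose X : 'M[R]_(1 + n) := block_mx 1%:M 0 (a^-1 *: c) X1.
pose Y : 'M[R]_(1 + n) := block_mx 1%:M (a^-1 *: b) 0 Y1.
pose d i := if i is i'.+1 then d1 i' else a.
pose D : 'M[R]_(1 + n) := diag_mx (\row_(i < n.+1) d i).
have A'XY : A' = X *m D *m Y.
  have -> : D = block_mx a%:M 0 0 (diag_mx (\row_(i < n) d1 i)).
    rewrite -[LHS](@submxK _ 1 n 1 n); congr block_mx; apply/matrixP => i j;
      rewrite !mxE -val_eqE //=.
    - by rewrite !ord1.
    - by rewrite ord1.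
    - by rewrite ord1.
  rewrite [LHS]A'b /X /Y !mulmx_block !(mul0mx, mulmx0, mul1mx, addr0, add0r, mulmx1).
  rewrite -SE mul_scalar_mx mul_mx_scalar !scalerA mulfV// !scale1r.
  by rewrite -scalemxAr /S -scalemxAl addrC subrK.
have le1 m1 m2 (B : 'M[R]_(m1, m2)) i j : `|B i j| <= `|a| -> `|(a^-1 *: B) i j| <= 1.
  by move=> Ba; rewrite mxE normrM normfV mulrC ler_pdivrMr ?normr_gt0// mul1r.
have Smax i j : `|S i j| <= 2 * `|a|.
  have -> : S i j = drsubmx A' i j - (a^-1 *: c) i 0 * b 0 j.
    by rewrite /S mxE [X in _ + X]mxE [in X in _ - X]mxE big_ord1.
  have drA : `|drsubmx A' i j| <= `|a| by rewrite !mxE.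
  have bA : `|b 0 j| <= `|a| by rewrite !mxE.
  have cA : `|(a^-1 *: c) i 0| <= 1 by apply: le1; rewrite !mxE.
  rewrite mulrDl !mul1r (le_trans (ler_normB _ _))// lerD// normrM.
  by rewrite -[leRHS]mul1r ler_pM.
have blk1 (B : 'M[R]_(1, n)) (C : 'M[R]_(n, 1)) (E : 'M[R]_n) :
    (forall i j, `|B i j| <= 1) -> (forall i j, `|C i j| <= 1) ->
    (forall i j, `|E i j| <= 1) ->
    forall i j, `|block_mx (1%:M : 'M[R]_1) B C E i j| <= 1.
  move=> B1 C1 E1 i j; rewrite mxE.
  case: (fintype.split i) => i'; rewrite mxE; case: (fintype.split j) => j' //.
  by rewrite !ord1 mxE eqxx normr1.
have X1' i j : `|X i j| <= 1.
  apply: blk1 => {}i {}j; [by rewrite mxE normr0| |by have [] := XY1 i j].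
  by apply: le1; rewrite /c !mxE.
have Y1' i j : `|Y i j| <= 1.
  apply: blk1 => {}i {}j; [|by rewrite mxE normr0|by have [] := XY1 i j].
  by apply: le1; rewrite /b !mxE.
have dX : `|\det X| = 1 by rewrite /X det_lblock det1 mul1r.
have dY : `|\det Y| = 1 by rewrite /Y det_ublock det1 mul1r.
exists (P *m X), (Y *m Q), d; split.
- by rewrite {1}AE A'XY !mulmxA.
- move=> i j; rewrite -xrowE -xcolE; split; [rewrite mxE|rewrite mxE]; [exact: X1'|exact: Y1'].
- by rewrite !det_mulmx !det_perm !normrM !normr_sign mul1r mulr1.
- by move=> M _ AM; exact: AM.
- case=> [_|i]; last exact: d1P.
  by split=> // n0; exact: d1max.
Qed.

End PivotDecomposition.

(** * Parallel lines *)

Lemma row_free_row_neq0 (K : fieldType) m n (A : 'M[K]_(m, n)) i :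
  row_free A -> row i A != 0.
Proof.
move=> /row_freeP[D AD]; apply/eqP => Ai; have := congr1 (row i) AD.
rewrite row_mul Ai mul0mx => /rowP/(_ i)/eqP.
by rewrite !mxE eqxx eq_sym oner_eq0.
Qed.

Section ParallelLines.
Variables (R : realType) (Pi : set (set (line R))).
Hypothesis hPi : topological_parallelism Pi.
Let parPi : parallelism Pi := hPi.1.

Lemma parallel_sym L M : parallel Pi L M -> parallel Pi M L.
Proof. by case=> S PS [SL SM]; exists S. Qed.

Lemma parallel_trans L M N : parallel Pi L M -> parallel Pi M N -> parallel Pi L N.
Proof.
move=> [S PS [SL SM]] [S' PS' [S'M S'N]]; exists S => //; split=> //.
have [S0 [_ uS0]] := parPi.2 M.
by rewrite -(uS0 S (conj PS SM)) (uS0 S' (conj PS' S'M)).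
Qed.

(** A spread has only one line through the common point [v]. *)
Lemma parallel_meet (B C : 'M[R]_(2, 4)) (L M : line R) (v : 'rV[R]_4) :
  parallel Pi L M -> spans B L -> spans C M ->
  v != 0 -> (v <= B)%MS -> (v <= C)%MS -> L = M.
Proof.
move=> [S PS [SL SM]] BL CM v0 vB vC.
have [p vp] : exists p : grass R 1, spans v p.
  by apply: exists_span; rewrite -row_leq_rank rank_rV v0.
have [N [_ uN]] := parPi.1 S PS p.
rewrite -(uN L) ?(uN M)//; split=> //; rewrite /incident.
  by rewrite (spans_sub vp CM).
by rewrite (spans_sub vp BL).
Qed.

(** The plane is given as the kernel of the column [z]. *)
Lemma parallel_plane (B C : 'M[R]_(2, 4)) (L M : line R) (z : 'cV[R]_4) :
  parallel Pi L M -> spans B L -> spans C M ->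
  z != 0 -> B *m z = 0 -> C *m z = 0 -> L = M.
Proof.
move=> LM BL CM z0 Bz Cz.
(* All four rows of [A] lie in the plane, hence are dependent, and a dependency yields a common
   point of the two lines. *)
pose A : 'M[R]_(2 + 2, 4) := col_mx B C.
have Az : A *m z = 0 by rewrite /A mul_col_mx Bz Cz col_mx0.
have : ~~ row_free A.
  rewrite (row_free_unit (A : 'M[R]_4)); apply: contraNN z0 => uA.
  by rewrite -(mulKmx uA z) [X in _ *m X]Az mulmx0.
rewrite -kermx_eq0 => /rowV0Pn[c /sub_kermxP]; rewrite -[c]hsubmxK.
set c1 := lsubmx c; set c2 := rsubmx c; rewrite mul_row_col => cA c0.
apply: (parallel_meet (v := c1 *m B) LM BL CM); last 2 first.
- exact: submxMl.
- by rewrite -(addrK (c2 *m C) (c1 *m B)) cA sub0r -mulNmx submxMl.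
apply: contraNneq c0 => c1B; move: cA; rewrite c1B add0r => /eqP.
have fB := spans_row_free BL; have fC := spans_row_free CM.
move/eqP: c1B; rewrite !mulmx_free_eq0// => /eqP-> /eqP->.
by rewrite row_mx0.
Qed.

Lemma exists_parallel (v : 'rV[R]_4) (L : line R) : v != 0 ->
  exists2 N, parallel Pi N L & exists2 B, spans B N & (v <= B)%MS.
Proof.
move=> v0; have [p vp] : exists p : grass R 1, spans v p.
  by apply: exists_span; rewrite -row_leq_rank rank_rV v0.
have [pN NL] := (parallel_throughP p L (parallel_through Pi p L) parPi).2 erefl.
exists (parallel_through Pi p L) => //.
have [B BN] := exists_frame (parallel_through Pi p L).
by exists B => //; rewrite -(spans_sub vp BN).
Qed.

Lemma cvg_parallel_through (T : Type) (F : set_system T) {FF : ProperFilter F}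
    (p : T -> grass R 1) (L : T -> line R) (p0 : grass R 1) (L0 : line R) :
  p @ F --> p0 -> L @ F --> L0 ->
  (fun t => parallel_through Pi (p t) (L t)) @ F --> parallel_through Pi p0 L0.
Proof.
move=> pp LL; exact: (cvg_comp (fun t => (p t, L t)) (fun pL : grass R 1 * line R =>
  parallel_through Pi pL.1 pL.2) (cvg_pair pp LL) (hPi.2 (p0, L0))).
Qed.

(** Writing [L t] as the parallel to [M t] through a convergent point of [L t] reduces the claim to
    continuity of the parallelism. *)
Lemma parallel_closed (T : Type) (F : set_system T) {FF : ProperFilter F}
    (L M : T -> line R) (L0 M0 : line R) :
  L @ F --> L0 -> M @ F --> M0 -> (\forall t \near F, parallel Pi (L t) (M t)) ->
  parallel Pi L0 M0.
Proof.
move=> LL0 MM0 LM; have [B BL0] := exists_frame L0.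
have [b bB bL] := cvg_frame LL0 BL0.
have row_neq0 (C : 'M[R]_(2, 4)) : row_free C -> row_free (row 0 C).
  by move=> fC; rewrite -row_leq_rank rank_rV row_free_row_neq0.
have [p0 Bp0] := exists_span (row_neq0 _ (spans_row_free BL0)).
(* The point is spanned by the first row of the frame; [p0] is a default where [b t] is not a
   frame. *)
have /choice[p bp] t : exists p : grass R 1, row_free (b t) -> spans (row 0 (b t)) p.
  case: (boolP (row_free (b t))) => [/row_neq0/exists_span[p]|_]; last by exists p0.
  by exists p.
have pp0 : p @ F --> p0.
  apply: (@cvg_span _ _ _ F p (fun t => row 0 (b t)) (row 0 B)) => //; last first.
    by apply: filterS bL => t /spans_row_free/bp.
  by under eq_fun do rewrite rowE; rewrite rowE; exact: cvg_mulmxl.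
have LE : \forall t \near F, parallel_through Pi (p t) (M t) = L t.
  apply: filterS2 bL LM => t bL LM.
  apply/esym/(parallel_throughP (p t) (M t) (L t) parPi); split=> //.
  by rewrite /incident (spans_sub (bp _ (spans_row_free bL)) bL) row_sub.
have : L @ F --> parallel_through Pi p0 M0.
  exact: near_cvg_eq LE (cvg_parallel_through pp0 MM0).
move=> /(grass_cvg_uniq LL0) E.
exact: ((parallel_throughP p0 M0 L0 parPi).2 E).2.
Qed.

Lemma cvg_collineation k (U : grass R k) (h : PGL4 R) :
  (fun g => collineation g U) @ h --> collineation h U.
Proof.
suff : continuous (fun g : PGL4 R => collineation g U) by apply.
apply/(@quotient_continuous (GL4 R) {eq_quot (@proportional R)}) => A.
have [B BU] := exists_frame U.
apply: (@cvg_span _ _ _ (nbhs A) _ (fun A' : GL4 R => B *m val A') (B *m val A)).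
- by apply: cvg_mulmxl; exact: initial_continuous.
- exact: spans_collineation.
- by near=> A'; exact: spans_collineation.
Unshelve. all: by end_near. Qed.

(** The forward implication passes to the limit because parallelity is closed. The converse follows
    from uniqueness of the parallel through a point. *)
Lemma closed_Aut : closed (Aut Pi).
Proof.
move=> h; rewrite closureEcvg => -[F FF [Fh FA]].
have Fcol k (U : grass R k) : (fun g => collineation g U) @ F --> collineation h U.
  by apply: cvg_trans (@cvg_collineation k U h); exact: cvg_app.
have FAut : \forall g \near F, Aut Pi g by apply: FA.
have imp L M : parallel Pi L M -> parallel Pi (collineation h L) (collineation h M).
  move=> LM; apply: (parallel_closed (Fcol _ L) (Fcol _ M)).
  by apply: filterS FAut => g /(_ L M)[+ _]; apply.
move=> L M; split; first exact: imp.
move=> hLM; have [B BM] := exists_frame M.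
have C0 : row 0 B != 0 by rewrite row_free_row_neq0// (spans_row_free BM).
(* [N] is the parallel to [L] through a point of [M]. The images of [N] and [M] under [h] are
   parallel and share a point, so they agree. *)
have [N NL [D DN CD]] := exists_parallel L C0.
suff NM : N = M by rewrite -NM; exact: parallel_sym.
have hK X : collineation h^-1%g (collineation h X) = X :> line R.
  by rewrite -collineationM mulgV collineation1.
rewrite -(hK N) -(hK M); congr collineation.
have := spans_collineation (repr h) DN; rewrite pgl_repr => DhN.
have := spans_collineation (repr h) BM; rewrite pgl_repr => BhM.
apply: (parallel_meet (v := row 0 B *m val (repr h)) _ DhN BhM).
- by apply: parallel_trans hLM; exact: imp.
- apply: contraNneq C0 => Bh0; apply/eqP.
  by rewrite -(mulmxK (GL4P (repr h)) (row 0 B)) Bh0 mul0mx.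
- exact: submxMr.
- by apply: submxMr; exact: row_sub.
Qed.

End ParallelLines.

(** * Degenerating sequences of automorphisms *)

Section RowVectors.
Variable K : fieldType.

Definition rows2 n (p q : 'rV[K]_n) : 'M[K]_(2, n) := col_mx p q.

Lemma rows2_sub m n (p q : 'rV[K]_n) (B : 'M[K]_(m, n)) :
  (rows2 p q <= B)%MS = (p <= B)%MS && (q <= B)%MS.
Proof. exact: (@col_mx_sub _ 1 1). Qed.

Lemma submx_rows2l n (p q : 'rV[K]_n) : (p <= rows2 p q)%MS.
Proof. by have := submx_refl (rows2 p q); rewrite rows2_sub => /andP[]. Qed.

Lemma submx_rows2r n (p q : 'rV[K]_n) : (q <= rows2 p q)%MS.
Proof. by have := submx_refl (rows2 p q); rewrite rows2_sub => /andP[]. Qed.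

Lemma mul_rows2 m n (p q : 'rV[K]_m) (A : 'M[K]_(m, n)) :
  rows2 p q *m A = rows2 (p *m A) (q *m A).
Proof. exact: (@mul_col_mx _ 1 1). Qed.

Lemma submx_rows2P n (p q v : 'rV[K]_n) :
  (v <= rows2 p q)%MS -> exists a b, v = a *: p + b *: q.
Proof.
case/submxP => D0 ->; pose D : 'M[K]_(1, 1 + 1) := D0.
have -> : D0 *m rows2 p q = D *m col_mx p q by [].
exists (lsubmx D 0 0), (rsubmx D 0 0).
by rewrite -[D in LHS]hsubmxK mul_row_col -!mul_scalar_mx -!mx11_scalar.
Qed.

Lemma row_free_rows2 n (p q : 'rV[K]_n) i j :
  p 0 i * q 0 j - p 0 j * q 0 i != 0 -> row_free (rows2 p q).
Proof.
move=> pq; rewrite -kermx_eq0; apply/rowV0P => c0 /sub_kermxP.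
pose c : 'M[K]_(1, 1 + 1) := c0; have -> : c0 *m rows2 p q = c *m col_mx p q by [].
rewrite -[c0]/c.
rewrite -[c]hsubmxK mul_row_col [lsubmx c]mx11_scalar [rsubmx c]mx11_scalar.
rewrite !mul_scalar_mx; set a := lsubmx c 0 0; set b := rsubmx c 0 0 => E.
have Ei : a * p 0 i + b * q 0 i = 0 by move/rowP/(_ i) : E; rewrite !mxE.
have Ej : a * p 0 j + b * q 0 j = 0 by move/rowP/(_ j) : E; rewrite !mxE.
have a0 : a = 0.
  apply: (mulIf pq); rewrite mul0r.
  by transitivity ((a * p 0 i + b * q 0 i) * q 0 j - (a * p 0 j + b * q 0 j) * q 0 i);
    [ring|rewrite Ei Ej !mul0r subrr].
have b0 : b = 0.
  apply: (mulIf pq); rewrite mul0r.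
  by transitivity ((a * p 0 j + b * q 0 j) * p 0 i - (a * p 0 i + b * q 0 i) * p 0 j);
    [ring|rewrite Ei Ej !mul0r subrr].
by rewrite a0 b0 !raddf0 row_mx0.
Qed.

Lemma rank2_dependent n (B : 'M[K]_(2, n)) (p q r : 'rV[K]_n) :
  (p <= B)%MS -> (q <= B)%MS -> (r <= B)%MS ->
  exists abc : K * K * K, abc != (0, 0, 0) /\
    abc.1.1 *: p + abc.1.2 *: q + abc.2 *: r = 0.
Proof.
move=> pB qB rB; pose C := col_mx (col_mx p q) r.
have CB : (C <= B)%MS by rewrite !col_mx_sub pB qB.
have : ~~ row_free C.
  rewrite -row_leq_rank -ltnNge (leq_ltn_trans (mxrankS CB))//.
  by rewrite (leq_ltn_trans (rank_leq_row B)).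
rewrite -kermx_eq0 => /rowV0Pn[c /sub_kermxP]; rewrite -[c]hsubmxK.
rewrite -[lsubmx c]hsubmxK !mul_row_col.
set c1 := lsubmx _; set c2 := rsubmx (lsubmx c); set c3 := rsubmx c => E c0.
exists (c1 0 0, c2 0 0, c3 0 0); split; last first.
  by rewrite -!mul_scalar_mx -!mx11_scalar.
apply: contraNneq c0 => -[c10 c20 c30].
by rewrite [c1]mx11_scalar [c2]mx11_scalar [c3]mx11_scalar c10 c20 c30 !raddf0 !row_mx0.
Qed.

Lemma submx_mulr_unit m1 m2 n (U : 'M[K]_n) (A : 'M[K]_(m1, n)) (B : 'M[K]_(m2, n)) :
  U \in unitmx -> (A *m U <= B *m U)%MS = (A <= B)%MS.
Proof. by move=> uU; rewrite submxMfree ?row_free_unit. Qed.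

Lemma mulmx_unit_eq0 m n (U : 'M[K]_n) (A : 'M[K]_(m, n)) :
  U \in unitmx -> (A *m U == 0) = (A == 0).
Proof. by move=> uU; rewrite mulmx_free_eq0 ?row_free_unit. Qed.

End RowVectors.

(** This triangular change of frame allows the two rows of a degenerating frame to be rescaled
    separately, so that each has a limit. *)
Lemma spans_rows2 (R : realType) (p q : 'rV[R]_4) (a b c : R) (U : line R) :
  a != 0 -> c != 0 -> spans (rows2 p q) U ->
  spans (rows2 (a *: p) (c *: (q - b *: p))) U.
Proof.
move=> a0 c0 pqU; rewrite /spans -pqU; apply/vspaceP => v; rewrite !mem_rowspan.
have pB : (p <= rows2 (a *: p) (c *: (q - b *: p)))%MS.
  by rewrite -[X in (X <= _)%MS](scalerK a0) scalemx_sub// submx_rows2l.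
apply/idP/idP => /submx_trans; apply; rewrite rows2_sub.
  have pq : (p <= rows2 p q)%MS by exact: submx_rows2l.
  apply/andP; split; apply: scalemx_sub => //; apply: addmx_sub.
    exact: submx_rows2r.
  by rewrite -scaleNr; exact: scalemx_sub.
rewrite pB /= -[X in (X <= _)%MS](subrK (b *: p) q) addmx_sub//; last exact: scalemx_sub.
by rewrite -[X in (X <= _)%MS](scalerK c0) scalemx_sub// submx_rows2r.
Qed.

Lemma cvg_rows2 (R : realType) (T : Type) (F : set_system T) {FF : ProperFilter F} n
    (f g : T -> 'rV[R]_n) (p q : 'rV[R]_n) :
  f @ F --> p -> g @ F --> q -> (fun t => rows2 (f t) (g t)) @ F --> rows2 p q.
Proof.
move=> /cvg_mxP fp /cvg_mxP gq; apply/cvg_mxP => i j; rewrite /rows2.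
under eq_fun do rewrite !mxE; rewrite !mxE.
by case: fintype.splitP => k _; [exact: fp|exact: gq].
Qed.

Section Dynamics.
Variables (R : realType) (Pi : set (set (line R))).
Hypothesis hPi : topological_parallelism Pi.
Variables (T : Type) (F : set_system T).
Context {FF : ProperFilter F}.
Variables (A : T -> GL4 R) (X Y : T -> 'M[R]_4) (d : T -> nat -> R).
Variables (X0 Y0 : 'M[R]_4) (rho : nat -> R).
Hypothesis autA : \forall t \near F, Aut Pi (pgl (A t)).
Hypothesis AE : forall t, val (A t) = X t *m diag_mx (\row_i d t i) *m Y t.
Hypothesis d_neq0 : forall t i, (i < 4)%N -> d t i != 0.
Hypothesis cvgX : X @ F --> X0.
Hypothesis cvgY : Y @ F --> Y0.
Hypothesis unitX0 : X0 \in unitmx.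
Hypothesis unitY0 : Y0 \in unitmx.
Hypothesis cvg_rho : forall i, (i.+1 < 4)%N ->
  (fun t => d t i.+1 / d t i) @ F --> rho i.

Local Notation o0 := (Ordinal (isT : 0 < 4)%N).
Local Notation o1 := (Ordinal (isT : 1 < 4)%N).
Local Notation o2 := (Ordinal (isT : 2 < 4)%N).
Local Notation o3 := (Ordinal (isT : 3 < 4)%N).
Local Notation e i := (delta_mx 0 i : 'rV[R]_4).

Lemma delta_row_neq0 (i : 'I_4) : e i != 0.
Proof. by apply/eqP => /rowP/(_ i)/eqP; rewrite !mxE !eqxx oner_eq0. Qed.

Lemma cvg_ratio i j : (i <= j)%N -> (j < 4)%N ->
  (fun t => d t j / d t i) @ F --> \prod_(i <= k < j) rho k.
Proof.
move=> /subnKC <-; elim: (j - i)%N => [|k IHk] ik4.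
  rewrite addn0 in ik4 *; rewrite big_geq//.
  by under eq_fun do rewrite divff ?d_neq0//; exact: cvg_cst.
rewrite addnS in ik4 *; rewrite big_nat_recr ?leq_addr//= mulrC.
under eq_fun => t.
  have -> : d t (i + k).+1 / d t i = (d t (i + k).+1 / d t (i + k)) * (d t (i + k) / d t i).
    by rewrite mulrA divfK// d_neq0// ltnW.
  over.
by apply: cvgM; [exact: cvg_rho|apply: IHk; exact: ltnW].
Qed.

Lemma parallel_limit (L M : T -> line R) L0 M0 :
  (\forall t \near F, parallel Pi (L t) (M t)) ->
  (fun t => collineation (pgl (A t)) (L t)) @ F --> L0 ->
  (fun t => collineation (pgl (A t)) (M t)) @ F --> M0 ->
  parallel Pi L0 M0.
Proof.
move=> LM AL AM; apply: (parallel_closed hPi AL AM).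
by apply: filterS2 autA LM => t At; exact: (At _ _).1.
Qed.

(** The limit of the matrices divided by their first pivot; the products of [rho] are the limits of
    [d t i / d t 0]. *)
Let Z := X0 *m diag_mx (\row_i \prod_(0 <= k < i) rho k) *m Y0.

Lemma cvg_rescaled : (fun t => (d t 0%N)^-1 *: val (A t)) @ F --> Z.
Proof.
under eq_fun do rewrite AE scalemxAl scalemxAr.
apply: cvg_mulmx => //; apply: cvg_mulmx => //.
apply/cvg_mxP => i j; under eq_fun do rewrite !mxE mulrnAr mulrC.
by rewrite !mxE; apply: cvgMn; exact: cvg_ratio.
Qed.

(** If [rho 2] vanished, [Z] would have rank 3 with kernel point [e o3 *m invmx X0], which lies on
    [L]. Lines parallel to [L] and different from it have limits in the image plane of [Z]; being
    parallel, these limits coincide, so that plane would collapse to a line. *)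
Lemma no_gap_last : rho 0%N != 0 -> rho 1%N != 0 -> rho 2%N != 0.
Proof.
move=> r0 r1; apply/eqP => r2.
pose D : 'M[R]_4 := diag_mx (\row_i \prod_(0 <= k < i) rho k).
(* As [Z *m z = 0], the column [z] describes the plane containing every limit [n *m Z]. *)
pose z := invmx Y0 *m (e o3)^T.
have De3 : D *m (e o3)^T = 0.
  apply/matrixP => i j; rewrite mul_diag_mx !mxE.
  rewrite !ord1 eqxx /=; case: eqP => [->|_]; last by rewrite mulr0.
  by rewrite /= big_nat_recr//= r2 mulr0 mul0r.
have [L e03L] : exists L : line R, spans (rows2 (e o0) (e o3) *m invmx X0) L.
  apply: exists_span; rewrite /row_free mxrankMfree; last by rewrite row_free_unit unitmx_inv.
  apply: (row_free_rows2 (i := o0) (j := o3)).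
  by rewrite !mxE /= mulr1 mul0r subr0 oner_neq0.
(* Such a [v] is off [L], so the parallel [N] to [L] through it misses the kernel point and [n *m Z]
   is still a frame. *)
have key (v : 'rV[R]_4) : v 0 o1 != 0 \/ v 0 o2 != 0 ->
    exists (N : line R) (n : 'M[R]_(2, 4)) (V : line R),
  [/\ parallel Pi N L, (v *m invmx X0 <= n)%MS, spans (n *m Z) V &
      (fun t => collineation (pgl (A t)) N) @ F --> V].
  move=> v12; have v0 : v *m invmx X0 != 0.
    rewrite mulmx_unit_eq0 ?unitmx_inv//; apply/eqP => v0.
    by case: v12; rewrite v0 mxE eqxx.
  have [N NL [n nN vn]] := exists_parallel hPi L v0.
  have e3n : ~~ (e o3 *m invmx X0 <= n)%MS.
    apply/negP => e3n.
    have NE : N = L.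
      apply: (parallel_meet hPi NL nN e03L _ e3n).
        by rewrite mulmx_unit_eq0 ?unitmx_inv// delta_row_neq0.
      by rewrite submx_mulr_unit ?unitmx_inv//; exact: submx_rows2r.
    move: vn; have /(spans_eqP nN e03L)/[swap] /submx_trans/[apply] := NE.
    rewrite submx_mulr_unit ?unitmx_inv// => /submx_rows2P[a [b vE]].
    by case: v12; rewrite vE !mxE /= !mulr0 addr0 eqxx.
  have fnZ : row_free (n *m Z).
    rewrite -kermx_eq0; apply/rowV0P => c /sub_kermxP; rewrite /Z !mulmxA => /eqP.
    rewrite mulmx_unit_eq0// => /eqP cD.
    have cE : c *m n *m X0 = (c *m n *m X0) 0 o3 *: e o3.
      apply/rowP => j; rewrite [RHS]mxE [X in _ = _ * X]mxE eqxx /=.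
      case: eqP => [->|/eqP j3]; rewrite ?mulr1// mulr0.
      move/rowP/(_ j): cD; rewrite mul_mx_diag !mxE => /eqP; rewrite mulf_eq0 => /orP[/eqP//|].
      case: j j3 => -[|[|[|[|//]]]] j4 //= _.
      - by rewrite big_geq// oner_eq0.
      - by rewrite big_nat1 (negbTE r0).
      - by rewrite big_nat_recr//= big_nat1 mulf_eq0 (negbTE r0) (negbTE r1).
    move: cE; set a := (c *m n *m X0) 0 o3; clearbody a => cE.
    have := spans_row_free nN; rewrite -kermx_eq0 => /rowV0P; apply.
    apply/sub_kermxP; apply/eqP; rewrite -(mulmx_unit_eq0 _ unitX0) cE scaler_eq0.
    apply/orP; left; apply: contraNT e3n => a0.
    have -> : e o3 *m invmx X0 = a^-1 *: c *m n.
      rewrite -scalemxAl -[c *m n in RHS](mulmxK unitX0) cE.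
      by rewrite -scalemxAl scalerA mulVf// scale1r.
    exact: submxMl.
  have [V nV] := exists_span fnZ.
  exists N, n, V; split=> //.
  apply: (@cvg_span _ _ _ _ _ (fun t => n *m ((d t 0%N)^-1 *: val (A t)))) nV _.
    by apply: cvg_mulmxl; exact: cvg_rescaled.
  apply: filterE => t; rewrite -scalemxAr -mul_scalar_mx; apply: spans_mull.
    by rewrite unitmxE det_scalar unitfE expf_neq0// invr_eq0 d_neq0.
  exact: spans_collineation.
(* The points [e o1], [e o2] and [e o0 + e o1] are off [L], and their images under [D] stay
   independent because [D] kills only multiples of [e o3]. *)
have e1 : e o1 0 o1 != 0 \/ e o1 0 o2 != 0 by left; rewrite !mxE oner_neq0.
have e2 : e o2 0 o1 != 0 \/ e o2 0 o2 != 0 by right; rewrite !mxE oner_neq0.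
have e01 : (e o0 + e o1) 0 o1 != 0 \/ (e o0 + e o1) 0 o2 != 0.
  by left; rewrite !mxE /= add0r oner_neq0.
have [N1 [n1 [V1 [N1L vn1 nV1 AN1]]]] := key _ e1.
have [N2 [n2 [V2 [N2L vn2 nV2 AN2]]]] := key _ e2.
have [N3 [n3 [V3 [N3L vn3 nV3 AN3]]]] := key _ e01.
have z0 : z != 0.
  apply/eqP => z0; have := mulKVmx unitY0 (e o3)^T; rewrite -/z z0 mulmx0.
  by move=> /matrixP/(_ o3 0)/eqP; rewrite !mxE eq_sym oner_eq0.
have nz (n : 'M[R]_(2, 4)) : n *m Z *m z = 0.
  by rewrite /Z /z !mulmxA mulmxK// -!mulmxA De3 !mulmx0.
have same N N' n n' V V' : parallel Pi N L -> parallel Pi N' L ->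
    spans (n *m Z) V -> spans (n' *m Z) V' ->
    (fun t => collineation (pgl (A t)) N) @ F --> V ->
    (fun t => collineation (pgl (A t)) N') @ F --> V' -> (n' *m Z <= n *m Z)%MS.
  move=> NL N'L nV nV' AN AN'; apply/(spans_eqP nV' nV).
  apply: (parallel_plane hPi _ nV' nV z0) => //.
  apply: (parallel_limit (L := fun=> N') (M := fun=> N)) AN' AN.
  by apply: filterE => t; exact: (parallel_trans hPi N'L (parallel_sym NL)).
have vZ (v : 'rV[R]_4) (n : 'M[R]_(2, 4)) : (v *m invmx X0 <= n)%MS ->
    (n *m Z <= n1 *m Z)%MS -> (v *m D *m Y0 <= n1 *m Z)%MS.
  move=> vn nn1; have := submx_trans (submxMr Z vn) nn1.
  by rewrite /Z -/D !mulmxA mulmxKV.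
have [[[a b] c] [abc0]] := rank2_dependent (vZ _ _ vn1 (submx_refl _))
  (vZ _ _ vn2 (same _ _ _ _ _ _ N1L N2L nV1 nV2 AN1 AN2))
  (vZ _ _ vn3 (same _ _ _ _ _ _ N1L N3L nV1 nV3 AN1 AN3)).
rewrite /= !scalemxAl -!mulmxDl => /eqP; rewrite mulmx_unit_eq0// => /eqP abcD.
have E (i : 'I_4) : (a *: e o1 + b *: e o2 + c *: (e o0 + e o1)) 0 i *
    (\prod_(0 <= k < i) rho k) = 0.
  by move/rowP/(_ i): abcD; rewrite mul_mx_diag !mxE.
have /eqP := E o0; rewrite !mxE /= big_geq// mulr1 !(mulr0, add0r, addr0, mulr1) => /eqP c0.
have /eqP := E o1; rewrite !mxE /= big_nat1 c0 !(mulr0, add0r, addr0, mulr1, mul0r).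
rewrite mulf_eq0 (negbTE r0) orbF => /eqP a0.
have /eqP := E o2; rewrite !mxE /= big_nat_recr//= big_nat1 c0 a0.
rewrite !(mulr0, add0r, addr0, mulr1, mul0r) !mulf_eq0.
rewrite (negbTE r0) (negbTE r1) !orbF => /eqP b0.
by rewrite a0 b0 c0 eqxx in abc0.
Qed.

Lemma prod_rho_eq0 (j : nat) : rho 0%N = 0 -> (0 < j)%N ->
  \prod_(0 <= k < j) rho k = 0.
Proof. by move=> r0 j0; rewrite big_ltn// r0 mul0r. Qed.

(** In the coordinates given by [X0], the line [N] joins a point [u] off the
    plane of vanishing coordinate [o0] to its intersection [h] with that plane. *)
Lemma cvg_line_gap_first (u h : 'rV[R]_4) (N V : line R) :
  rho 0%N = 0 -> u 0 o0 = 1 -> h 0 o0 = 0 ->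
  spans (rows2 u h *m invmx X0) N ->
  spans (rows2 (e o0) (\row_j (h 0 j * \prod_(1 <= k < j) rho k)) *m Y0) V ->
  (fun t => collineation (pgl (A t)) N) @ F --> V.
Proof.
move=> r0 u0 h0 uhN hV.
pose w t := u *m invmx X0 *m X t; pose w' t := h *m invmx X0 *m X t.
have wu j : (fun t => w t 0 j) @ F --> u 0 j.
  suff : w @ F --> u by move=> /cvg_mxP; apply.
  by rewrite -[X in _ --> X](mulmxKV unitX0); exact: cvg_mulmxl.
have w'h j : (fun t => w' t 0 j) @ F --> h 0 j.
  suff : w' @ F --> h by move=> /cvg_mxP; apply.
  by rewrite -[X in _ --> X](mulmxKV unitX0); exact: cvg_mulmxl.
have x0 : \forall t \near F, w t 0 o0 != 0.
  by apply: cvgr_neq0 (wu o0) _; rewrite u0 oner_neq0.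
have yx : (fun t => w' t 0 o0 / w t 0 o0) @ F --> 0.
  have -> : 0 = h 0 o0 / u 0 o0 by rewrite h0 mul0r.
  by apply: cvgM => //; apply: cvgV; rewrite // u0 oner_neq0.
(* [p] is scaled to first coordinate 1. In [q] the first coordinate is eliminated, and scaling by
   [d t 1] instead of [d t 0] keeps the remaining coordinates from all tending to 0 needlessly. *)
pose p t : 'rV[R]_4 := (d t 0%N * w t 0 o0)^-1 *: (w t *m diag_mx (\row_i d t i)).
pose q t : 'rV[R]_4 := (d t 1%N)^-1 *: (w' t *m diag_mx (\row_i d t i) -
  (w' t 0 o0 / w t 0 o0) *: (w t *m diag_mx (\row_i d t i))).
apply: (@cvg_span _ _ _ _ _ (fun t => rows2 (p t) (q t) *m Y t)) hV _; last first.
  apply: filterS x0 => t x0; rewrite mul_rows2 /p /q -!scalemxAl mulmxBl -scalemxAl.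
  rewrite -!mulmxA !(mulmxA (X t)) -AE !mulmxA; apply: spans_rows2.
  - by rewrite invr_eq0 mulf_neq0 ?d_neq0.
  - by rewrite invr_eq0 d_neq0.
  - by rewrite -mul_rows2 -mul_rows2; exact: spans_collineation.
apply: cvg_mulmx => //; apply: cvg_rows2; apply/cvg_mxP => i j; rewrite !ord1.
  have -> : e o0 0 j = u 0 j / u 0 o0 * \prod_(0 <= k < j) rho k.
    rewrite mxE eqxx /= u0 divr1; case: eqP => [->|/eqP j0].
      by rewrite big_geq// u0 mulr1.
    by rewrite prod_rho_eq0 ?mulr0// lt0n.
  have -> : (fun t => p t 0 j) = (fun t => w t 0 j / w t 0 o0 * (d t j / d t 0%N)).
    apply/funext => t; rewrite mxE mul_mx_diag !mxE invfM; ring.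
  apply: cvgM; last exact: cvg_ratio.
  by apply: cvgM => //; apply: cvgV; rewrite // u0 oner_neq0.
have qE t : q t 0 j = (w' t 0 j - w' t 0 o0 / w t 0 o0 * w t 0 j) * (d t j / d t 1%N).
  by rewrite mxE mxE !mul_mx_diag !mxE; ring.
(* For [j = o0] the ratio [d t 0 / d t 1] blows up, but its coefficient vanishes exactly near
   [F]. *)
rewrite mxE; have [j0|j0] := eqVneq j o0.
  rewrite j0 in qE *; rewrite h0 mul0r; apply: near_cvg_eq (cvg_cst (0 : R)).
  by apply: filterS x0 => t x0; rewrite qE divfK// subrr mul0r.
under eq_fun do rewrite qE.
have -> : h 0 j = h 0 j - 0 * u 0 j by rewrite mul0r subr0.
apply: cvgM; last by apply: cvg_ratio; rewrite // lt0n.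
by apply: cvgB => //; exact: cvgM.
Qed.

(** The limits given by [cvg_line_gap_first] all pass through [e o0 *m Y0], so parallel ones
    coincide, while a nonzero [rho 1] preserves the coordinate [o2] of the point in the plane H.
    This forces parallels to [L] through many points of H into H, where they all coincide. *)
Lemma gap_first : rho 0%N = 0 -> rho 1%N = 0.
Proof.
move=> r0; apply/eqP/negPn/negP => r1.
have unitV : invmx X0 \in unitmx by rewrite unitmx_inv.
have fr (p q : 'rV[R]_4) i j (U : 'M[R]_4) : U \in unitmx ->
    p 0 i * q 0 j - p 0 j * q 0 i != 0 ->
    exists V : line R, spans (rows2 p q *m U) V.
  move=> uU /row_free_rows2 fpq; apply: exists_span.
  by rewrite /row_free mxrankMfree// row_free_unit.
have [L e01L] : exists L : line R, spans (rows2 (e o0) (e o1) *m invmx X0) L.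
  by apply: (fr _ _ o0 o1) => //; rewrite !mxE /= mulr1 mul0r subr0 oner_neq0.
have [V e01V] : exists V : line R, spans (rows2 (e o0) (e o1) *m Y0) V.
  by apply: (fr _ _ o0 o1) => //; rewrite !mxE /= mulr1 mul0r subr0 oner_neq0.
have LV : (fun t => collineation (pgl (A t)) L) @ F --> V.
  apply: cvg_line_gap_first e01L _ => //; try by rewrite !mxE.
  congr (spans (rows2 _ _ *m Y0) V) : e01V; apply/rowP => j; rewrite !mxE /=.
  by case: eqP => [->|_]; rewrite ?mul0r// big_geq ?mulr1.
(* The column of the plane H on which the coordinate [o0] vanishes. *)
pose z := X0 *m (e o0)^T.
have z0 : z != 0.
  apply/eqP => z0; have := mulKmx unitX0 (e o0)^T; rewrite -/z z0 mulmx0.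
  by move=> /matrixP/(_ o0 0)/eqP; rewrite !mxE eq_sym oner_eq0.
(* If [N] were not in H, its limit [W] would meet [V] in [e o0 *m Y0] and hence equal [V]. But the
   coordinate [o2] of [h'] is [rho 1], whereas it is 0 on [V]. *)
have nH (h : 'rV[R]_4) (N : line R) (n : 'M[R]_(2, 4)) :
    h 0 o0 = 0 -> h 0 o2 = 1 -> parallel Pi N L -> spans n N ->
    (h *m invmx X0 <= n)%MS -> n *m z = 0.
  move=> h0 h2 NL nN hn; apply/eqP/negPn/negP => nz.
  have [i nXi] : exists i, (n *m X0) i o0 != 0.
    apply/existsP; apply: contraNT nz => /existsPn nXi; apply/eqP/matrixP => i j.
    rewrite mulmxA trmx_delta -colE [RHS]mxE mxE; apply/eqP/negPn; exact: nXi.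
  (* A point of [N] off H, normalised to first coordinate 1. *)
  pose u := ((n *m X0) i o0)^-1 *: row i (n *m X0).
  have u0 : u 0 o0 = 1 by rewrite mxE [X in _ * X]mxE mulVf.
  have [N' uhN'] : exists N' : line R, spans (rows2 u h *m invmx X0) N'.
    by apply: (fr _ _ o0 o2) => //; rewrite u0 h2 h0 mulr0 subr0 mulr1 oner_neq0.
  have N'N : N' = N.
    apply/(spans_eqP uhN' nN); rewrite mul_rows2 rows2_sub hn andbT.
    by rewrite -scalemxAl row_mul -mulmxA mulmxV// mulmx1 scalemx_sub// row_sub.
  rewrite N'N in uhN'.
  set h' : 'rV[R]_4 := \row_j (h 0 j * \prod_(1 <= k < j) rho k).
  have h'2 : h' 0 o2 = rho 1%N by rewrite mxE /= big_nat1 h2 mul1r.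
  have [W hW] : exists W : line R, spans (rows2 (e o0) h' *m Y0) W.
    by apply: (fr _ _ o0 o2) => //; rewrite h'2 !mxE /= mul0r subr0 mul1r.
  have NW := cvg_line_gap_first r0 u0 h0 uhN' hW.
  have VW : parallel Pi W V by apply: (parallel_limit (filterE _ _) NW LV).
  have WV : W = V.
    apply: (parallel_meet hPi (v := e o0 *m Y0) VW hW e01V).
    - by rewrite mulmx_unit_eq0// delta_row_neq0.
    - by rewrite submxMr// submx_rows2l.
    - by rewrite submxMr// submx_rows2l.
  move/(spans_eqP hW e01V) : WV; rewrite submx_mulr_unit// rows2_sub => /andP[_].
  case/submx_rows2P => a [b h'E]; move: r1; rewrite -h'2 h'E !mxE /=.
  by rewrite !mulr0 addr0 eqxx.
have inP (h : 'rV[R]_4) : h 0 o2 = 1 -> h 0 o0 = 0 ->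
    exists (N : line R) (n : 'M[R]_(2, 4)),
      [/\ parallel Pi N L, spans n N, (h *m invmx X0 <= n)%MS & n *m z = 0].
  move=> h2 h0; have hV : h *m invmx X0 != 0.
    rewrite mulmx_unit_eq0//; apply/eqP => hE.
    by move/eqP: h2; rewrite hE mxE eq_sym oner_eq0.
  have [N NL [n nN hn]] := exists_parallel hPi L hV.
  by exists N, n; split=> //; exact: (nH h N n).
(* The points [e o2], [e o2 + e o1] and [e o2 + e o3] of H are not collinear, yet would lie on one
   line. *)
have [||N1 [n1 [N1L nN1 hn1 nz1]]] := inP (e o2); try by rewrite !mxE.
have same N n : parallel Pi N L -> spans n N -> n *m z = 0 -> (n <= n1)%MS.
  move=> NL nN nz; apply/(spans_eqP nN nN1).
  apply: (parallel_plane hPi _ nN nN1 z0) => //.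
  exact: (parallel_trans hPi NL (parallel_sym N1L)).
have [||N2 [n2 [N2L nN2 hn2 nz2]]] := inP (e o2 + e o1).
- by rewrite !mxE /= addr0.
- by rewrite !mxE /= addr0.
have [||N3 [n3 [N3L nN3 hn3 nz3]]] := inP (e o2 + e o3).
- by rewrite !mxE /= addr0.
- by rewrite !mxE /= addr0.
have [[[a b] c] [abc0]] := rank2_dependent hn1 (submx_trans hn2 (same _ _ N2L nN2 nz2))
  (submx_trans hn3 (same _ _ N3L nN3 nz3)).
rewrite /= !scalemxAl -!mulmxDl => /eqP; rewrite mulmx_unit_eq0// => /eqP/rowP E.
have := E o1; rewrite !mxE /= !(mulr0, add0r, addr0, mulr1) => b0.
have := E o3; rewrite !mxE /= !(mulr0, add0r, addr0, mulr1) => c0.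
have := E o2; rewrite !mxE /= b0 c0 !(mul0r, mulr0, add0r, addr0, mulr1) => a0.
by rewrite a0 b0 c0 eqxx in abc0.
Qed.

Lemma unitX t : X t \in unitmx.
Proof. by have := GL4P (A t); rewrite AE !unitmx_mul => /andP[/andP[]]. Qed.

(** In the coordinates of [X0] the kernel line K is spanned by [e o2] and [e o3], so invertibility
    of the left block says that [N0] misses K. With [n *m X = (a, b)], the image has the frame with
    blocks 1 and [D1' *m (invmx a *m b) *m D2] in the coordinates of [Y], and the second block tends
    to 0. *)
Lemma cvg_parallel_gap_middle (N : T -> line R) (N0 V : line R) (n0 : 'M[R]_(2, 4)) :
  rho 1%N = 0 -> N @ F --> N0 -> spans n0 N0 ->
  lsubmx (n0 *m X0 : 'M[R]_(2, 2 + 2)) \in unitmx ->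
  spans ((row_mx 1%:M 0 : 'M[R]_(2, 2 + 2)) *m Y0) V ->
  (fun t => collineation (pgl (A t)) (N t)) @ F --> V.
Proof.
move=> r1 NN0 n0N0 ua0 hV; have [n nn0 nN] := cvg_frame NN0 n0N0.
pose a t := lsubmx (n t *m X t : 'M[R]_(2, 2 + 2)).
pose b t := rsubmx (n t *m X t : 'M[R]_(2, 2 + 2)).
have /cvg_mxP nX : (fun t => n t *m X t) @ F --> n0 *m X0 by exact: cvg_mulmx.
have aa0 : a @ F --> lsubmx (n0 *m X0 : 'M[R]_(2, 2 + 2)).
  by apply/cvg_mxP => i j; under eq_fun do rewrite mxE; rewrite mxE; exact: nX.
have bb0 : b @ F --> rsubmx (n0 *m X0 : 'M[R]_(2, 2 + 2)).
  by apply/cvg_mxP => i j; under eq_fun do rewrite mxE; rewrite mxE; exact: nX.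
have ua : \forall t \near F, a t \in unitmx by exact: near_unitmx aa0 ua0.
have /cvg_mxP ab : (fun t => invmx (a t) *m b t) @ F -->
    invmx (lsubmx (n0 *m X0 : 'M[R]_(2, 2 + 2))) *m rsubmx (n0 *m X0 : 'M[R]_(2, 2 + 2)).
  by apply: cvg_mulmx => //; exact: cvg_invmx.
pose D1 t : 'M[R]_2 := diag_mx (\row_i d t i).
pose D1' t : 'M[R]_2 := diag_mx (\row_i (d t i)^-1).
pose D2 t : 'M[R]_2 := diag_mx (\row_(i < 2) d t (2 + i)%N).
pose E t : 'M[R]_(2, 2 + 2) := row_mx 1%:M (D1' t *m (invmx (a t) *m b t) *m D2 t).
have D1K t : D1' t *m D1 t = 1%:M.
  apply/matrixP => i j; rewrite mul_diag_mx !mxE; case: eqP => [->|_]; last by rewrite mulr0.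
  by rewrite mulr1n mulVf// d_neq0// (ltn_trans (ltn_ord j)).
have DE t : diag_mx (\row_i d t i) = block_mx (D1 t) 0 0 (D2 t) :> 'M[R]_(2 + 2).
  rewrite -diag_mx_row; congr diag_mx; apply/rowP => i; rewrite !mxE.
  by case: fintype.splitP => k ->; rewrite mxE.
apply: (@cvg_span _ _ _ _ _ (fun t => E t *m Y t)) hV _; last first.
  apply: filterS2 ua nN => t ut nt.
  have -> : E t *m Y t = D1' t *m invmx (a t) *m (n t *m val (A t)).
    have nXE : n t *m X t *m diag_mx (\row_i d t i) = row_mx (a t *m D1 t) (b t *m D2 t).
      transitivity (row_mx (a t) (b t) *m block_mx (D1 t) 0 0 (D2 t)).
        by rewrite -DE /a /b hsubmxK.
      by rewrite mul_row_block !mulmx0 addr0 add0r.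
    rewrite AE !(mulmxA (n t)) nXE mulmxA; congr (_ *m Y t).
    have e1 : D1' t *m invmx (a t) *m (a t *m D1 t) = 1%:M by rewrite -mulmxA mulKmx.
    have e2 : D1' t *m invmx (a t) *m (b t *m D2 t) =
      D1' t *m (invmx (a t) *m b t) *m D2 t by rewrite !mulmxA.
    by rewrite /E -e1 -e2 -[LHS]mul_mx_row.
  apply: spans_mull; last exact: spans_collineation.
  by rewrite unitmx_mul unitmx_inv ut andbT; have [] := mulmx1_unit (D1K t).
apply: cvg_mulmx => //; apply/cvg_mxP => i j; rewrite /E.
under eq_fun do rewrite mxE; rewrite mxE.
case: fintype.splitP => k _; first exact: cvg_cst.
under eq_fun do rewrite mul_mx_diag mxE mul_diag_mx mxE [X in X * _ * _]mxE
  [X in _ * _ * X]mxE.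
have -> : (0 : 'M[R]_2) i k = (invmx (lsubmx (n0 *m X0 : 'M[R]_(2, 2 + 2))) *m
    rsubmx (n0 *m X0 : 'M[R]_(2, 2 + 2))) i k * 0 by rewrite mxE mulr0.
under eq_fun do rewrite mulrAC mulrC; apply: cvgM; first exact: ab.
under eq_fun do rewrite mulrC.
(* Every pivot ratio from the first block to the second contains the factor [rho 1]. *)
have -> : 0 = \prod_(i <= l < 2 + k) rho l.
  apply/esym/eqP; rewrite prodf_seq_eq0; apply/hasP; exists 1%N; last by rewrite r1 eqxx.
  by rewrite mem_index_iota -ltnS ltn_ord /= addSn ltnS leq_addr.
apply: cvg_ratio; last by rewrite (ltn_add2l 2).
by rewrite (leq_trans (ltnW (ltn_ord i)))// leq_addr.
Qed.

(** In the coordinates of [Y0], the images of [M t] tend to the line of [e o0] and [e o2], those of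
    the parallels [N t] to the line of [e o0] and [e o1]. These parallel limits meet in one point
    but differ. *)
Lemma gap_middle : rho 1%N != 0.
Proof.
apply/eqP => r1.
have unitV : invmx X0 \in unitmx by rewrite unitmx_inv.
have fr (U : 'M[R]_4) : U \in unitmx ->
    exists V : line R, spans (rows2 (e o0) (e o2) *m U) V.
  move=> uU; apply: exists_span; rewrite /row_free mxrankMfree ?row_free_unit//.
  by apply: (row_free_rows2 (i := o0) (j := o2)); rewrite !mxE /= mulr1 mul0r subr0 oner_neq0.
(* Using the coordinates of [X t] instead of [X0] makes the image of [M t] explicit for every [t],
   although the limit [M0] meets K. *)
have /choice[M e02M] t : exists M : line R, spans (rows2 (e o0) (e o2) *m invmx (X t)) M.
  by apply: fr; rewrite unitmx_inv unitX.
have [M0 e02M0] := fr _ unitV.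
have MM0 : M @ F --> M0.
  apply: cvg_span e02M0 (filterE _ e02M); apply: cvg_mulmxl; exact: cvg_invmx.
(* This point lies in the plane joining [M0] and K, where the coordinate [o1] vanishes, but on
   neither line. *)
have s0 : (e o0 + e o3) *m invmx X0 != 0.
  rewrite mulmx_unit_eq0//; apply/eqP => /rowP/(_ o0)/eqP.
  by rewrite !mxE /= addr0 oner_eq0.
have [p sp] : exists p : grass R 1, spans ((e o0 + e o3) *m invmx X0) p.
  by apply: exists_span; rewrite -row_leq_rank rank_rV s0.
pose N t := parallel_through Pi p (M t); pose N0 := parallel_through Pi p M0.
have NN0 : N @ F --> N0 by apply: (cvg_parallel_through hPi _ MM0); exact: cvg_cst.
have thr L : incident p (parallel_through Pi p L) /\ parallel Pi (parallel_through Pi p L) L.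
  by apply/(parallel_throughP p L _ hPi.1).
have NM t : parallel Pi (N t) (M t) by have [] := thr (M t).
have [sN0 N0M0] := thr M0; rewrite -/N0 in sN0 N0M0.
have [n0 n0N0] := exists_frame N0; rewrite /incident (spans_sub sp n0N0) in sN0.
have ev (i : 'I_4) (v : 'rV[R]_4) : v *m (e i)^T = (v 0 i)%:M.
  by rewrite trmx_delta -colE [LHS]mx11_scalar mxE.
have ua : lsubmx (n0 *m X0 : 'M[R]_(2, 2 + 2)) \in unitmx.
  (* If [N0] met K in a point [v], it would lie with [M0] in the plane of vanishing coordinate [o1].
     It would then equal [M0], which misses [e o0 + e o3]. *)
  apply: contraT => nua; exfalso.
  have [c ca c0] : exists2 c : 'rV[R]_2,
      c *m lsubmx (n0 *m X0 : 'M[R]_(2, 2 + 2)) = 0 & c != 0.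
    by move: nua; rewrite -row_free_unit -kermx_eq0 => /rowV0Pn[c /sub_kermxP]; exists c.
  pose v := c *m (n0 *m X0).
  have vl (i : 'I_2) : v 0 (lshift 2 i : 'I_(2 + 2)) = 0.
    transitivity ((c *m lsubmx (n0 *m X0 : 'M[R]_(2, 2 + 2))) 0 i); last by rewrite ca mxE.
    by rewrite !mxE; apply: eq_bigr => j _; rewrite [in RHS]mxE.
  have v00 : v 0 o0 = 0 by rewrite -(vl ord0); congr (v 0 _); exact: val_inj.
  have v01 : v 0 o1 = 0 by rewrite -(vl ord_max); congr (v 0 _); exact: val_inj.
  have /rV0Pn[j vj] : v != 0.
    by rewrite /v mulmxA mulmx_unit_eq0// mulmx_free_eq0 ?(spans_row_free n0N0).
  have [N1 svN1] : exists N1 : line R, spans (rows2 (e o0 + e o3) v *m invmx X0) N1.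
    apply: exists_span; rewrite /row_free mxrankMfree ?row_free_unit//.
    have s00 : (e o0 + e o3) 0 o0 = 1 by rewrite !mxE /= addr0.
    by apply: (row_free_rows2 (i := o0) (j := j)); rewrite v00 s00 mulr0 subr0 mul1r.
  have N10 : N1 = N0.
    apply/(spans_eqP svN1 n0N0); rewrite mul_rows2 rows2_sub sN0 /v mulmxA mulmxK//.
    exact: submxMl.
  pose z := X0 *m (e o1)^T.
  have z0 : z != 0.
    apply/eqP => z0; have := mulKmx unitX0 (e o1)^T; rewrite -/z z0 mulmx0.
    by move=> /matrixP/(_ o1 0)/eqP; rewrite !mxE eq_sym oner_eq0.
  have rz (q q' : 'rV[R]_4) : q 0 o1 = 0 -> q' 0 o1 = 0 -> rows2 q q' *m invmx X0 *m z = 0.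
    move=> q1 q'1; rewrite /z mulmxA mulmxKV// mul_rows2 !ev q1 q'1 !raddf0.
    by apply/matrixP => i k; rewrite /rows2 !mxE; case: fintype.splitP => l _; rewrite mxE.
  have : N1 = M0.
    rewrite -N10 in N0M0.
    by apply: (parallel_plane hPi N0M0 svN1 e02M0 z0); apply: rz => //; rewrite !mxE //= addr0.
  move/(spans_eqP svN1 e02M0); rewrite submx_mulr_unit// rows2_sub => /andP[+ _].
  case/submx_rows2P => a [b] /rowP/(_ o3)/eqP; rewrite !mxE /= !mulr0 !addr0 add0r.
  by rewrite oner_eq0.
pose E : 'M[R]_(2, 2 + 2) := row_mx 1%:M 0.
have [V EV] : exists V : line R, spans (E *m Y0) V.
  apply: exists_span; rewrite /row_free mxrankMfree ?row_free_unit//.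
  apply/row_freeP; exists (col_mx 1%:M 0).
  by rewrite mul_row_col mulmx1 mulmx0 addr0.
have [W e02W] := fr _ unitY0.
have NV := cvg_parallel_gap_middle r1 NN0 n0N0 ua EV.
have MW : (fun t => collineation (pgl (A t)) (M t)) @ F --> W.
  apply: (@cvg_span _ _ _ _ _ (fun t => rows2 (e o0) (e o2) *m Y t)) e02W _.
    exact: cvg_mulmxl.
  apply: filterE => t; have := spans_collineation (A t) (e02M t).
  rewrite AE !mulmxA mulmxKV ?unitX// !mul_rows2 -!rowE !row_diag_mx !mxE /=.
  have d0V : (d t 0%N)^-1 != 0 by rewrite invr_eq0 d_neq0.
  have d2V : (d t 2%N)^-1 != 0 by rewrite invr_eq0 d_neq0.
  rewrite -!scalemxAl => /(spans_rows2 0 d0V d2V).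
  by rewrite scale0r subr0 !scalerK ?d_neq0// -!rowE.
have VW : V = W.
  apply: (parallel_meet hPi (v := e o0 *m Y0) _ EV e02W).
  - exact: (parallel_limit (filterE _ NM) NV MW).
  - by rewrite mulmx_unit_eq0// delta_row_neq0.
  - apply: submxMr; have -> : e o0 = (delta_mx 0 0 : 'rV[R]_2) *m E; last exact: submxMl.
    rewrite /E mul_mx_row mulmx1 mulmx0; apply/rowP => i; rewrite !mxE.
    by case: fintype.splitP => k ik; rewrite !mxE -!val_eqE /= ik.
  - by apply: submxMr; exact: submx_rows2l.
move/esym/(spans_eqP e02W EV) : VW; rewrite submx_mulr_unit// rows2_sub => /andP[_].
case/submxP => c e2E; have : e o2 = row_mx c 0.
  by rewrite -[c in RHS]mulmx1 -(mulmx0 _ c) -mul_mx_row; exact: e2E.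
move=> /rowP/(_ o2); rewrite !mxE; case: fintype.splitP => k /= k2.
  by have := ltn_ord k; rewrite -k2.
by rewrite mxE => /eqP; rewrite oner_eq0.
Qed.

Lemma rho_neq0 i : (i < 3)%N -> rho i != 0.
Proof.
have r0 : rho 0%N != 0 by apply: contraNneq gap_middle => /gap_first ->.
by case: i => [|[|[|//]]] _; [|exact: gap_middle|exact: no_gap_last gap_middle].
Qed.

Lemma unitZ : Z \in unitmx.
Proof.
rewrite /Z !unitmx_mul unitX0 unitY0 andbT /= unitmxE det_diag unitfE.
apply/prodf_neq0 => i _; rewrite mxE prodf_seq_neq0; apply/allP => k.
rewrite mem_index_iota /= => ki; apply: rho_neq0; apply: leq_trans ki _.
by rewrite -ltnS ltn_ord.
Qed.

Lemma cvg_pgl : exists h : PGL4 R, (fun t => pgl (A t)) @ F --> h.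
Proof.
exists (pgl (mkGL4 unitZ)).
have uZ t : (d t 0%N)^-1 *: val (A t) \in unitmx.
  by rewrite unitmxZ ?GL4P// unitfE invr_eq0 d_neq0.
have -> : (fun t => pgl (A t)) = (fun t => pgl (mkGL4 (uZ t))).
  apply/funext => t; apply/pgl_eqP; exists (d t 0%N); first exact: d_neq0.
  by rewrite /= scalerA divff ?d_neq0// scale1r.
apply: (cvg_comp (fun t => mkGL4 (uZ t)) (@pgl R)); last exact: pi_continuous.
by apply: cvg_set_type; exact: cvg_rescaled.
Qed.

End Dynamics.

(** * Compactness of the automorphism group *)

Section CompactAut.
Variables (R : realType) (Pi : set (set (line R))).
Hypothesis hPi : topological_parallelism Pi.

Lemma compact_Aut : compact (Aut Pi).
Proof.
rewrite compact_ultra => F FU FA.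
have /choice[X /choice[Y /choice[d dec]]] (g : PGL4 R) := pivot_decomposition (GL4P (repr g)).
have [X0 XX0] : exists X0 : 'M[R]_4, X @ F --> X0.
  by apply: (@ultra_bounded_mx_cvg _ _ _ FU _ _ X 1); apply: filterE => g i j;
    have [_ /(_ i j)[]] := dec g.
have [Y0 YY0] : exists Y0 : 'M[R]_4, Y @ F --> Y0.
  by apply: (@ultra_bounded_mx_cvg _ _ _ FU _ _ Y 1); apply: filterE => g i j;
    have [_ /(_ i j)[]] := dec g.
have unit_lim (W : PGL4 R -> 'M[R]_4) (W0 : 'M[R]_4) : (forall g, `|\det (W g)| = 1) ->
    W @ F --> W0 -> W0 \in unitmx.
  move=> W1 WW0; have dW : (fun g => `|\det (W g)|) @ F --> `|\det W0|.
    by apply: cvg_norm; exact: cvg_det.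
  have d1 : (fun g => `|\det (W g)|) @ F --> (1 : R).
    by under eq_fun do rewrite W1; exact: cvg_cst.
  by rewrite unitmxE unitfE -normr_eq0 (cvg_unique (@Rhausdorff R) dW d1) oner_neq0.
have uX0 : X0 \in unitmx by apply: unit_lim XX0 => g; have [_ _ []] := dec g.
have uY0 : Y0 \in unitmx by apply: unit_lim YY0 => g; have [_ _ []] := dec g.
have d0 g i : (i < 4)%N -> d g i != 0 by have [_ _ _ _ dP] := dec g; case/dP.
(* There are only three ratios; 0 is the default for larger indices. *)
have /choice[rho drho] (i : nat) : exists r : R, (i.+1 < 4)%N ->
    (fun g => d g i.+1 / d g i) @ F --> r.
  have [i4|i4] := boolP (i.+1 < 4)%N; last by exists 0.
  have [r dr] : exists r : R, (fun g => d g i.+1 / d g i) @ F --> r.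
    apply: (@ultra_bounded_cvg _ _ _ FU _ 2); apply: filterE => g.
    have [_ _ _ _ dP] := dec g; have [di /(_ i4)] := dP i (ltnW i4).
    by rewrite normrM normfV ler_pdivrMr ?normr_gt0.
  by exists r.
have decE g : val (repr g) = X g *m diag_mx (\row_i d g i) *m Y g by have [] := dec g.
have Freg : \forall g \near F, Aut Pi (pgl (repr g)).
  by apply: filterS FA => g; rewrite /= pgl_repr.
have [h] := cvg_pgl hPi Freg decE d0 XX0 YY0 uX0 uY0 drho.
under eq_fun do rewrite pgl_repr; move=> Fh.
exists h; split; last exact: Fh.
apply: (closed_Aut hPi); rewrite closureEcvg; exists F; first exact: ultra_proper.
by split=> // B AB; exact: filterS FA.
Qed.

End CompactAut.

(** * Invariant forms of bounded groups *)

Section FrobeniusSquare.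
Variable R : realType.

(** The squared Frobenius norm. *)
Definition sqn m n (S : 'M[R]_(m, n)) : R := \sum_i \sum_j S i j ^+ 2.

Lemma sqn_ge0 m n (S : 'M[R]_(m, n)) : 0 <= sqn S.
Proof. by apply: sumr_ge0 => i _; apply: sumr_ge0 => j _; exact: sqr_ge0. Qed.

Lemma sqn_trmx m n (S : 'M[R]_(m, n)) : sqn S^T = sqn S.
Proof.
rewrite /sqn exchange_big; apply: eq_bigr => i _; apply: eq_bigr => j _.
by rewrite mxE.
Qed.

Lemma sqr_entry_le_sqn m n (S : 'M[R]_(m, n)) i j : S i j ^+ 2 <= sqn S.
Proof.
rewrite /sqn (bigD1 i)//= (bigD1 j)//= -addrA lerDl addr_ge0//.
  by apply: sumr_ge0 => k _; exact: sqr_ge0.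
by apply: sumr_ge0 => k _; apply: sumr_ge0 => l _; exact: sqr_ge0.
Qed.

Lemma sqn_eq0 m n (S : 'M[R]_(m, n)) : sqn S <= 0 -> S = 0.
Proof.
move=> S0; apply/matrixP => i j; rewrite mxE; apply/eqP.
by rewrite -sqrf_eq0 eq_le sqr_ge0 andbT (le_trans (sqr_entry_le_sqn S i j)).
Qed.

Lemma sqn_rowE n (v : 'rV[R]_n) : (v *m v^T) 0 0 = sqn v.
Proof.
by rewrite mxE /sqn big_ord1; apply: eq_bigr => j _; rewrite mxE -expr2.
Qed.

(** The parallelogram law, in the form that expresses strict convexity. *)
Lemma sqn_midpoint m n (S T : 'M[R]_(m, n)) :
  sqn (2^-1 *: (S + T)) = 2^-1 * sqn S + 2^-1 * sqn T - 4^-1 * sqn (S - T).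
Proof.
rewrite /sqn !mulr_sumr -!big_split -sumrB; apply: eq_bigr => i _ /=.
rewrite !mulr_sumr -!big_split -sumrB; apply: eq_bigr => j _ /=.
by rewrite !mxE; field.
Qed.

Lemma sqn_mulmx_le m n p (C : R) : exists2 k : R, 0 < k &
  forall (P : 'M[R]_(m, n)) (Q : 'M[R]_(n, p)), (forall i j, `|Q i j| <= C) ->
  sqn (P *m Q) <= k * sqn P.
Proof.
(* Each of the [m * p] entries of the product has square at most [(n%:R * C) ^+ 2 * sqn P]; the
   added 1 makes the constant positive. *)
exists ((n%:R * C) ^+ 2 *+ p *+ m + 1).
  by rewrite ltr_wpDl// !mulrn_wge0// sqr_ge0.
move=> P Q QC; have entry i j : ((P *m Q) i j) ^+ 2 <= (n%:R * C) ^+ 2 * sqn P.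
  have le_sqrt k : `|P i k| <= Num.sqrt (sqn P).
    by rewrite -sqrtr_sqr ler_wsqrtr// sqr_entry_le_sqn.
  rewrite -[sqn P]sqr_sqrtr ?sqn_ge0// -exprMn -real_normK ?num_real//.
  have le1 : `|(P *m Q) i j| <= n%:R * C * Num.sqrt (sqn P).
    have -> : n%:R * C * Num.sqrt (sqn P) = \sum_(k < n) C * Num.sqrt (sqn P).
      by rewrite sumr_const card_ord -mulrA mulr_natl.
    rewrite mxE (le_trans (ler_norm_sum _ _ _))//; apply: ler_sum => k _.
    by rewrite normrM mulrC ler_pM.
  by rewrite lerXn2r ?nnegrE// (le_trans _ le1).
rewrite /sqn (le_trans (_ : _ <= \sum_(i < m) \sum_(j < p) (n%:R * C) ^+ 2 * sqn P))//.
  by apply: ler_sum => i _; apply: ler_sum => j _; exact: entry.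
rewrite !sumr_const !card_ord mulrDl mul1r -!mulrnAl -[leLHS]addr0.
by rewrite lerD// sqn_ge0.
Qed.

Lemma normr_le_sqr (x M : R) : x ^+ 2 <= M -> `|x| <= 1 + M.
Proof. by move=> xM; rewrite ler_norml; apply/andP; split; nra. Qed.

End FrobeniusSquare.

Section InvariantForm.
Variables (R : realType) (n : nat) (G : set 'M[R]_n) (C : R).
Hypothesis G1 : G 1%:M.
Hypothesis GM : forall A B, G A -> G B -> G (A *m B).
Hypothesis GV : forall A, G A -> exists2 B, G B & A *m B = 1%:M /\ B *m A = 1%:M.
Hypothesis GC : forall A, G A -> forall i j, `|A i j| <= C.

Let act (A S : 'M[R]_n) := A *m S *m A^T.

Lemma sqn_act_le : exists2 k : R, 0 < k &
  forall A, G A -> forall S, sqn (act A S) <= k * sqn S.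
Proof.
have [k k0 kP] := sqn_mulmx_le n n n C.
exists (k * k); first exact: mulr_gt0.
move=> A GA S; have GTC i j : `|A^T i j| <= C by rewrite mxE; exact: GC.
apply: (le_trans (kP _ _ GTC)); rewrite -mulrA ler_pM2l// -sqn_trmx trmx_mul.
by rewrite (le_trans (kP _ _ GTC))// sqn_trmx.
Qed.

(** One lower bound along the whole orbit makes the condition stable under [G] and midpoints, and,
    unlike strict positivity, under limits. *)
Definition uniformly_positive (S : 'M[R]_n) : Prop := S^T = S /\
  forall A, G A -> forall v : 'rV[R]_n, sqn v <= (v *m act A S *m v^T) 0 0.

(** A large scalar form works: [v] is the product of [v *m A] with the inverse of [A], whose entries
    are bounded as well. *)
Lemma exists_uniformly_positive : exists S, uniformly_positive S.
Proof.
have [k k0 kP] := sqn_mulmx_le 1 n n C.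
exists k%:M; split; first exact: tr_scalar_mx.
move=> A GA v; have [B GB [AB _]] := GV GA.
rewrite /act mul_mx_scalar -scalemxAl -scalemxAr -scalemxAl mxE.
have -> : v *m (A *m A^T) *m v^T = (v *m A) *m (v *m A)^T by rewrite trmx_mul !mulmxA.
rewrite sqn_rowE -[v in leLHS]mulmx1 -AB mulmxA.
by apply: kP; exact: GC.
Qed.

Lemma act_mul A B S : act A (act B S) = act (A *m B) S.
Proof. by rewrite /act trmx_mul !mulmxA. Qed.

Lemma uniformly_positive_act A S : G A -> uniformly_positive S ->
  uniformly_positive (act A S).
Proof.
move=> GA [Ssym Spos]; split; first by rewrite /act !trmx_mul trmxK Ssym mulmxA.
by move=> B GB v; rewrite act_mul; apply: Spos; exact: GM.
Qed.

Lemma act_midpoint A S T : act A (2^-1 *: (S + T)) = 2^-1 *: (act A S + act A T).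
Proof. by rewrite /act -scalemxAr -scalemxAl mulmxDr mulmxDl. Qed.

Lemma uniformly_positive_midpoint S T : uniformly_positive S -> uniformly_positive T ->
  uniformly_positive (2^-1 *: (S + T)).
Proof.
move=> [Ssym Spos] [Tsym Tpos]; split; first by rewrite linearZ/= linearD/= Ssym Tsym.
move=> A GA v; rewrite act_midpoint -scalemxAr -scalemxAl mulmxDr mulmxDl.
rewrite mxE [X in _ * X]mxE; have := Spos A GA v; have := Tpos A GA v; lra.
Qed.

Let max_sqn (S : 'M[R]_n) := sup [set sqn (act A S) | A in G].

Lemma sqn_act_le_sup A S : G A -> sqn (act A S) <= max_sqn S.
Proof.
move=> GA; apply: ub_le_sup; last by exists A.
have [k _ kP] := sqn_act_le; exists (k * sqn S) => _ [B GB <-].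
exact: kP.
Qed.

Lemma sup_act_le S M : (forall A, G A -> sqn (act A S) <= M) -> max_sqn S <= M.
Proof.
move=> SM; apply: ge_sup; first by exists (sqn (act 1%:M S)), 1%:M.
by move=> _ [A GA <-]; exact: SM.
Qed.

Let min_max_sqn := inf [set max_sqn S | S in uniformly_positive].

Lemma min_max_sqn_le S : uniformly_positive S -> min_max_sqn <= max_sqn S.
Proof.
move=> US; apply: ge_inf; last by exists S.
exists 0 => _ [T _ <-]; apply: le_trans (sqn_act_le_sup T G1); exact: sqn_ge0.
Qed.

(** A minimising sequence is bounded, and along an ultrafilter its limit inherits all the closed
    conditions. *)
Lemma exists_minimizer : exists2 S, uniformly_positive S & max_sqn S <= min_max_sqn.
Proof.
have hinf : has_inf [set max_sqn S | S in uniformly_positive].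
  split; first by have [S US] := exists_uniformly_positive; exists (max_sqn S), S.
  exists 0 => _ [T _ <-]; apply: le_trans (sqn_act_le_sup T G1); exact: sqn_ge0.
have /choice[S SP] (k : nat) : exists S, uniformly_positive S /\
    max_sqn S < min_max_sqn + k.+1%:R^-1.
  have k0 : 0 < k.+1%:R^-1 :> R by rewrite invr_gt0 ltr0n.
  by have [_ [S US <-]] := inf_adherent k0 hinf; exists S.
have [U [UU eU]] := ultraFilterLemma (@eventually_filter).
have [S0 SS0] : exists S0 : 'M[R]_n, S @ U --> S0.
  (* Since [1%:M] is in [G], [sqn (S k)] is at most [max_sqn (S k)], hence at most
     [min_max_sqn + 1]; [normr_le_sqr] adds the outer 1. *)
  apply: (@ultra_bounded_mx_cvg _ _ _ UU _ _ S (1 + (min_max_sqn + 1))).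
  apply: filterE => k i j; have [US Sk] := SP k.
  apply: normr_le_sqr; apply: le_trans (sqr_entry_le_sqn _ _ _) _.
  have := sqn_act_le_sup (S k) G1; rewrite /act trmx1 mulmx1 mul1mx => /le_trans; apply.
  by rewrite (le_trans (ltW Sk))// lerD2l invf_le1 ?ler1n ?ltr0n.
have act_cvg A : (fun k => act A (S k)) @ U --> act A S0.
  by apply: cvg_mulmxr; exact: cvg_mulmxl.
exists S0.
  split.
    have ST : S @ U --> S0^T.
      have -> : S = fun k => (S k)^T by apply/funext => k; rewrite (SP k).1.1.
      exact: cvg_trmx.
    exact: cvg_mx_uniq ST SS0.
  move=> A GA v.
  have /cvg_mxP/(_ 0 0) : (fun k => v *m act A (S k) *m v^T) @ U --> v *m act A S0 *m v^T.
    by apply: cvg_mulmxr; exact: cvg_mulmxl.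
  move=> /(ler_cvg_to (cvg_cst (sqn v))); apply; apply: filterE => k.
  exact: (SP k).1.2.
apply: sup_act_le => A GA.
have sq_cvg : (fun k => sqn (act A (S k))) @ U --> sqn (act A S0).
  have /cvg_mxP ac := act_cvg A.
  apply: cvg_sumr => i _; apply: cvg_sumr => j _.
  by apply: (cvg_comp _ (fun x : R => x ^+ 2) (ac i j)); exact: exprn_continuous.
have inv_cvg : (fun k : nat => min_max_sqn + k.+1%:R^-1) @ U --> min_max_sqn.
  rewrite -[X in _ --> X]addr0; apply: cvgD; first exact: cvg_cst.
  by apply: cvg_trans (@cvg_harmonic R); exact: cvg_app.
apply: (ler_cvg_to sq_cvg inv_cvg); apply: filterE => k.
exact: le_trans (sqn_act_le_sup _ GA) (ltW (SP k).2).
Qed.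

(** A minimizer [S] and its translate [act A S] have midpoint value below the minimum by a multiple
    of [sqn (S - act A S)], which must therefore vanish. *)
Lemma exists_invariant_form : exists2 S, uniformly_positive S & forall A, G A -> act A S = S.
Proof.
have [S US Smin] := exists_minimizer; exists S => // A GA.
have [k k0 kP] := sqn_act_le.
have UAS := uniformly_positive_act GA US.
have dec : max_sqn (2^-1 *: (S + act A S)) <=
    min_max_sqn - 4^-1 * (k^-1 * sqn (S - act A S)).
  apply: sup_act_le => B GB; rewrite act_midpoint sqn_midpoint act_mul.
  have l1 := le_trans (sqn_act_le_sup S GB) Smin.
  have l2 := le_trans (sqn_act_le_sup S (GM GB GA)) Smin.
  have [B' GB' [_ B'B]] := GV GB.
  (* The norm bound for the inverse [B'] gives a lower bound uniform in [B]. *)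
  have l3 : k^-1 * sqn (S - act A S) <= sqn (act B S - act (B *m A) S).
    rewrite ler_pdivrMl//.
    have -> : act B S - act (B *m A) S = act B (S - act A S).
      by rewrite -act_mul /act mulmxBr mulmxBl.
    have := kP _ GB' (act B (S - act A S)).
    by rewrite act_mul B'B /act trmx1 mulmx1 mul1mx.
  lra.
have := le_trans (min_max_sqn_le (uniformly_positive_midpoint US UAS)) dec.
move=> le0; have {le0} : k^-1 * sqn (S - act A S) <= 0 by lra.
by rewrite pmulr_rle0 ?invr_gt0// => /sqn_eq0/eqP; rewrite subr_eq0 => /eqP.
Qed.

End InvariantForm.

(** * Cholesky factorization *)

Section Cholesky.
Variable R : realType.

(** Induction on the Schur complement [T] of the corner entry, which inherits symmetry and
    positivity. Positivity also excludes a kernel of [Q]. *)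
Lemma cholesky n (S : 'M[R]_n) : S^T = S ->
  (forall v : 'rV[R]_n, v != 0 -> 0 < (v *m S *m v^T) 0 0) ->
  exists2 Q : 'M[R]_n, Q \in unitmx & S = Q *m Q^T.
Proof.
move=> Ssym Spos; suff [Q SQ] : exists Q : 'M[R]_n, S = Q *m Q^T.
  exists Q => //; rewrite -row_free_unit -kermx_eq0; apply/rowV0P => v /sub_kermxP vQ.
  apply/eqP/negPn/negP => /Spos.
  by rewrite SQ mulmxA vQ !mul0mx mxE ltxx.
elim: n S Ssym Spos => [|n IHn] S Ssym Spos.
  by exists 0; apply/matrixP => -[].
pose S' : 'M[R]_(1 + n) := S.
pose a := S' 0 0; pose b := ursubmx S'.
have a0 : 0 < a.
  have := Spos (delta_mx 0 0); rewrite trmx_delta -rowE -colE !mxE; apply.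
  by apply/eqP => /rowP/(_ 0)/eqP; rewrite !mxE !eqxx oner_eq0.
have S'E : S' = block_mx a%:M b b^T (drsubmx S').
  rewrite -[LHS]submxK; congr block_mx.
    apply/matrixP => i j; rewrite !ord1 [RHS]mxE mulr1n /a !mxE.
    by congr (S' _ _); exact: val_inj.
  by rewrite /b trmx_ursub [S'^T]Ssym.
have S'sym : S'^T = S' by exact: Ssym.
have S'pos (v : 'rV[R]_(1 + n)) : v != 0 -> 0 < (v *m S' *m v^T) 0 0 by exact: Spos.
have SS' : S = S' by [].
clearbody S'; pose T := drsubmx S' - a^-1 *: (b^T *m b).
pose L : 'M[R]_(1 + n) := block_mx 1%:M 0 (a^-1 *: b^T) 1%:M.
pose D (U : 'M[R]_n) (x : R) : 'M[R]_(1 + n) := block_mx x%:M 0 0 U.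
have LDL : S' = L *m D T a *m L^T.
  rewrite [LHS]S'E /L /D tr_block_mx !mulmx_block !trmx1 trmx0 linearZ /= trmxK.
  rewrite !(mul0mx, mulmx0, mul1mx, mulmx1, addr0, add0r).
  rewrite mul_mx_scalar mul_scalar_mx !scalerA mulfV ?gt_eqF// !scale1r.
  by rewrite -scalemxAr /T addrC subrK.
have uL : L \in unitmx by rewrite unitmxE /L det_lblock !det1 mulr1 unitr1.
have Tsym : T^T = T.
  by rewrite /T linearB /= linearZ /= trmx_mul trmxK trmx_drsub S'sym.
have Tpos (w : 'rV[R]_n) : w != 0 -> 0 < (w *m T *m w^T) 0 0.
  move=> w0; pose v := row_mx 0 w *m invmx L.
  have v0 : v != 0.
    apply: contraNneq w0 => v0; have : row_mx (0 : 'rV[R]_1) w = 0.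
      by rewrite -[LHS](mulmxKV uL) -/v v0 mul0mx.
    by move/eqP; rewrite row_mx_eq0 => /andP[].
  have vL : v *m L = row_mx 0 w by rewrite mulmxKV.
  have := S'pos v v0; rewrite LDL !mulmxA vL -(mulmxA _ L^T) -trmx_mul vL.
  by rewrite /D mul_row_block tr_row_mx mul_row_col !(mul0mx, mulmx0, add0r, addr0).
have [Q1 TQ] := IHn T Tsym Tpos.
have DQ : D T a = D Q1 (Num.sqrt a) *m (D Q1 (Num.sqrt a))^T.
  rewrite /D tr_block_mx mulmx_block !trmx0 !(mul0mx, mulmx0, add0r, addr0) -TQ.
  by rewrite tr_scalar_mx -scalar_mxM -expr2 sqr_sqrtr ?ltW.
exists (L *m D Q1 (Num.sqrt a)).
by rewrite SS' LDL DQ trmx_mul !mulmxA.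
Qed.

End Cholesky.

(** * Conjugating a compact subgroup into PO(4,R) *)

Section ConjugateToOrthogonal.
Variables (R : realType) (H : set (PGL4 R)).
Hypothesis subgroupH : is_subgroup H.
Hypothesis compactH : compact H.

(** Numerator and denominator are both homogeneous of degree 4, so the ratio descends to PGL(4,R);
    where the determinant has modulus 1 it controls the entries. *)
Let norm_ratio (A : GL4 R) : R := sqn (val A) ^+ 2 / `|\det (val A)|.

Lemma norm_ratio_continuous : continuous norm_ratio.
Proof.
move=> A; suff key (F : set_system (GL4 R)) : ProperFilter F ->
    (fun B : GL4 R => val B) @ F --> val A -> norm_ratio @ F --> norm_ratio A.
  by apply: key (nbhs_pfilter A) _; exact: initial_continuous.
move=> FF vA; have vij i j : (fun B : GL4 R => val B i j) @ F --> val A i j.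
  by move: i j; apply/cvg_mxP.
have sq (f : GL4 R -> R) (l : R) : f @ F --> l -> (fun B => f B ^+ 2) @ F --> l ^+ 2.
  by move=> fl; apply: (cvg_comp f (fun x : R => x ^+ 2) fl); exact: exprn_continuous.
have sv : (fun B : GL4 R => sqn (val B) ^+ 2) @ F --> sqn (val A) ^+ 2.
  by apply: (sq); apply: cvg_sumr => i _; apply: cvg_sumr => j _; exact: sq.
apply: cvgM sv _; apply: cvgV; first by rewrite normr_eq0 -unitfE -unitmxE GL4P.
by apply: cvg_norm; exact: cvg_det.
Qed.

Lemma norm_ratio_proportional A B : pgl A = pgl B -> norm_ratio A = norm_ratio B.
Proof.
move=> /pgl_eqP[c c0 AB]; rewrite /norm_ratio AB detZ.
have -> : sqn (c *: val B) = c ^+ 2 * sqn (val B).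
  rewrite /sqn mulr_sumr; apply: eq_bigr => i _; rewrite mulr_sumr.
  by apply: eq_bigr => j _; rewrite mxE exprMn.
rewrite normrM ger0_norm ?exprn_even_ge0// exprMn -exprM invfM mulrACA divff ?mul1r//.
by rewrite expf_neq0.
Qed.

Let unimodular : set 'M[R]_4 :=
  [set A | exists2 B : GL4 R, val B = A & H (pgl B) /\ `|\det A| = 1].

Lemma unimodular_bounded : exists C : R, forall A, unimodular A -> forall i j, `|A i j| <= C.
Proof.
have cf : continuous (norm_ratio \o repr : PGL4 R -> R).
  apply: repr_comp_continuous; first exact: norm_ratio_continuous.
  by move=> A B /eqP AB; apply/eqP/norm_ratio_proportional.
have : compact ((norm_ratio \o repr : PGL4 R -> R) @` H).
  by apply: continuous_compact => //; exact: continuous_subspaceT.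
move=> /compact_bounded[M [_ MP]].
(* The bound on the ratio holds above [M], here at [M + 1]. Two uses of [normr_le_sqr] pass from the
   square of [sqn] to [sqn] and then to an entry. *)
exists (1 + (1 + (M + 1))) => A [B BA [HB dA]] i j.
have := MP (M + 1) _ (norm_ratio (repr (pgl B))) (ex_intro2 _ _ _ HB erefl).
rewrite ltrDl ltr01 => /(_ isT).
rewrite (norm_ratio_proportional (pgl_repr (pgl B))) /norm_ratio BA dA invr1 mulr1 => AM.
apply: normr_le_sqr; apply: le_trans (sqr_entry_le_sqn _ _ _) _.
apply: le_trans (ler_norm _) _; apply: normr_le_sqr.
exact: le_trans (ler_norm _) AM.
Qed.

Lemma subgroup_mul g h : H g -> H h -> H (g * h)%g.
Proof.
move=> Hg Hh; rewrite -[h]invgK; apply: subgroupH.2 => //.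
by rewrite -[(h^-1)%g]mul1g; apply: subgroupH.2 => //; exact: subgroupH.1.
Qed.

Lemma subgroup_inv g : H g -> H (g^-1)%g.
Proof.
by move=> Hg; rewrite -[(g^-1)%g]mul1g; apply: subgroupH.2 => //; exact: subgroupH.1.
Qed.

Lemma exists_unimodular_repr g : H g -> exists2 A : GL4 R, pgl A = g & unimodular (val A).
Proof.
move=> Hg; pose B := val (repr g); have uB : B \in unitmx := GL4P (repr g).
(* The fourth root of the modulus of the determinant, since scaling by [c^-1] multiplies the
   determinant by its fourth power. *)
pose c := Num.sqrt (Num.sqrt `|\det B|).
have dB : 0 < `|\det B| by rewrite normr_gt0 -unitfE -unitmxE.
have c0 : 0 < c by rewrite !sqrtr_gt0.
have uA : c^-1 *: B \in unitmx by rewrite unitmxZ// unitfE invr_eq0 gt_eqF.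
have gA : pgl (mkGL4 uA) = g.
  rewrite -[RHS]pgl_repr; apply/pgl_eqP; exists c^-1 => //.
  by rewrite invr_eq0 gt_eqF.
exists (mkGL4 uA) => //; exists (mkGL4 uA) => //; rewrite gA; split=> //.
rewrite /= detZ normrM ger0_norm ?exprn_even_ge0//.
have c4 : c ^+ 4 = `|\det B| by rewrite (exprM _ 2 2) !sqr_sqrtr ?sqrtr_ge0// ltW.
by rewrite exprVn c4 mulVf// gt_eqF.
Qed.

(** If [A] preserves the form [Q *m Q^T], then [invmx Q *m A *m Q] is orthogonal. *)
Lemma conj_into_PO4 : exists g : PGL4 R, forall x, H x -> PO4 R (x ^ g)%g.
Proof.
have [C GC] := unimodular_bounded.
have [|_ _ [A <- [HA dA]] [B <- [HB dB]]|_ [A <- [HA dA]]||S US Sinv] :=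
  @exists_invariant_form R 4 unimodular C.
- exists 1%g => //; split; first by rewrite pgl1; exact: subgroupH.1.
  by rewrite det1 normr1.
- exists (A * B)%g => //; rewrite pglM; split; first exact: subgroup_mul.
  by rewrite det_mulmx normrM dA dB mulr1.
- exists (val A^-1%g); last by rewrite mulmxV ?mulVmx ?GL4P.
  exists A^-1%g => //; rewrite pglV; split; first exact: subgroup_inv.
  by rewrite det_inv normfV dA invr1.
- exact: GC.
have [Ssym Spos] := US.
have G1 : unimodular 1%:M.
  exists 1%g => //; split; first by rewrite pgl1; exact: subgroupH.1.
  by rewrite det1 normr1.
have [v v0|Q uQ SQ] := cholesky Ssym.
  have := Spos _ G1 v; rewrite trmx1 mulmx1 mul1mx; apply: lt_le_trans.
  rewrite lt_neqAle sqn_ge0 andbT eq_sym; apply: contraNneq v0 => v0.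
  by apply/eqP/sqn_eq0; rewrite v0.
exists (pgl (mkGL4 uQ)) => x Hx; have [A <- GA] := exists_unimodular_repr Hx.
rewrite conjgE -pglV -(pglM A) -pglM; exists ((mkGL4 uQ)^-1 * (A * mkGL4 uQ))%g; last by [].
rewrite /= !trmx_mul trmx_inv -!mulmxA (mulmxA Q) -SQ.
rewrite (mulmxA S) (mulmxA (val A)) (mulmxA (val A)) Sinv// SQ.
by rewrite -!mulmxA mulmxV ?unitmx_tr// mulmx1 mulVmx.
Qed.

End ConjugateToOrthogonal.

(** * Continuity of conjugation and closedness of the conjugate group *)

Lemma conjg_continuous (R : realType) (g : PGL4 R) :
  continuous (fun x : PGL4 R => (x ^ g)%g).
Proof.
apply/(@quotient_continuous (GL4 R) {eq_quot (@proportional R)}).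
have -> : (fun x : PGL4 R => (x ^ g)%g) \o \pi_(PGL4 R) =
    @pgl R \o (fun B : GL4 R => (repr g)^-1 * (B * repr g))%g.
  by apply/funext => B /=; rewrite conjgE !pglM pglV pgl_repr.
move=> A; apply: cvg_comp; last exact: pi_continuous.
suff key (F : set_system (GL4 R)) : ProperFilter F ->
    (fun B : GL4 R => val B) @ F --> val A ->
    (fun B : GL4 R => (repr g)^-1 * (B * repr g))%g @ F --> ((repr g)^-1 * (A * repr g))%g.
  by apply: key (nbhs_pfilter A) _; exact: initial_continuous.
move=> FF vA; apply: cvg_set_type; rewrite /=.
by apply: cvg_mulmxl; exact: cvg_mulmxr.
Qed.

Theorem theorem1p1 (R : realType) (Pi : set (set (line R)))
    (hPi : topological_parallelism Pi) :
  compact (Aut Pi) /\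
  exists2 H : set (PGL4 R),
    [/\ is_subgroup H, closed H & H `<=` PO4 R] &
    exists g : PGL4 R, H = [set (x ^ g)%g | x in Aut Pi].
Proof.
split; first exact: compact_Aut.
have [g gPO] := conj_into_PO4 (is_subgroup_Aut Pi) (compact_Aut hPi).
exists [set (x ^ g)%g | x in Aut Pi]; last by exists g.
have [A1 AV] := is_subgroup_Aut Pi; split.
- split; first by exists 1%g => //; rewrite conj1g.
  move=> _ _ [x Ax <-] [y Ay <-]; exists (x * y^-1)%g; first exact: AV.
  by rewrite conjMg conjVg.
(* Rewriting the image as a preimage under the inverse conjugation reduces closedness to
   continuity. *)
- have -> : [set (x ^ g)%g | x in Aut Pi] = (fun x : PGL4 R => (x ^ g^-1)%g) @^-1` Aut Pi.
    apply/seteqP; split=> [_ [x Ax <-]|x Ax] /=; first by rewrite conjgK.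
    by exists (x ^ g^-1)%g; rewrite ?conjgKV.
  by apply: closed_comp (closed_Aut hPi) => x _; exact: conjg_continuous.
- by move=> _ [x Ax <-]; exact: gPO.
Qed.
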